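(* Consider the mean-shift model $y=X\beta^\star+\mu^\star+\varepsilon$ with $X\in\mathbb{R}^{n\times p}$ deterministic with columns of unit Euclidean norm, $|\beta^\star|_0\le k$ and $|\mu^\star|_0\le s$ for positive integers $k,s$, and $\varepsilon\sim\mathcal N(0,\sigma^2I_n)$. Let $\lambda_i=\sigma\sqrt{\log(2n/i)}$, $i=1,\dots,n$, let $\nu=4\sigma\sqrt{\log p}$, let $\rho\ge2(4+\sqrt2)$, assume $\sqrt{\log p}\ge\rho\log2/4$, and let $$(\hat\beta,\hat\mu)\in\arg\min_{\beta\in\mathbb{R}^p,\mu\in\mathbb{R}^n}\Big\{\|y-X\beta-\mu\|_2^2+2\nu\|\beta\|_1+2\rho J_\lambda(\mu)\Big\}.$$ Let $k_1=16k\log p/\log2$ and $s_1=s\log(2en/s)/\log2$, and suppose there are constants $\kappa_1>2\kappa_2>0$ such that for all $(\beta,\mu)\in\mathbb{R}^p\times\mathbb{R}^n$ satisfying $$\|\beta\|_1+\sum_{j=1}^n\frac{\lambda_j}{\lambda_n}|\mu|_{(j)}\le5\big(\sqrt{k_1}\|\beta\|_2+\sqrt{s_1}\|\mu\|_2\big)$$ one has $\|X\beta\|_2^2+\|\mu\|_2^2\ge\kappa_1(\|\beta\|_2^2+\|\mu\|_2^2)$ and $|\langle X\beta,\mu\rangle|\le\kappa_2(\|\beta\|_2^2+\|\mu\|_2^2)$. Let $\kappa=\sqrt{\kappa_1-2\kappa_2}$. Then, with probability at least $1-\frac12(s/2n)^s-1/p$, $$\|\hat\beta-\beta^\star\|_2^2+\|\hat\mu-\mu^\star\|_2^2\le\frac{36}{\kappa^4}\sigma^2k\log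 p+\frac{4\rho^2}{\kappa^4}\sum_{j=1}^s\lambda_j^2\le\frac{4\sigma^2}{\kappa^4}\Big(9k\log p+\rho^2s\log\Big(\frac{2en}{s}\Big)\Big).$$
   Context: For $u\in\mathbb{R}^m$, $|u|_0$ is the number of nonzero entries of $u$, and $|u|_{(1)}\ge\dots\ge|u|_{(m)}$ are the absolute values of its entries sorted in non-increasing order. For a vector $\lambda\in\mathbb{R}^m$ with non-negative non-increasing entries, the sorted-$\ell_1$ norm is $J_\lambda(x)=\sum_{j=1}^m\lambda_j|x|_{(j)}$. *)

(* Defs.v *)
From HB Require Import structures.
From mathcomp Require Import all_boot all_order all_algebra.
From mathcomp Require Import all_classical all_reals all_analysis.
Set Implicit Arguments. Unset Strict Implicit. Unset Printing Implicit Defensive.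
Import Order.TTheory GRing.Theory Num.Theory.
Local Open Scope classical_set_scope.
Local Open Scope ring_scope.

Definition l0 {R : realType} {m : nat} (u : 'I_m -> R) : nat :=
  #|[set i : 'I_m | u i != 0]|.

Definition l1 {R : realType} {m : nat} (u : 'I_m -> R) : R := \sum_i `|u i|.
Definition sqnorm {R : realType} {m : nat} (u : 'I_m -> R) : R := \sum_i u i ^+ 2.
Definition l2 {R : realType} {m : nat} (u : 'I_m -> R) : R := Num.sqrt (sqnorm u).
Definition dotp {R : realType} {m : nat} (u v : 'I_m -> R) : R := \sum_i u i * v i.

Definition mulXv {R : realType} {n p : nat} (X : 'M[R]_(n, p)) (b : 'I_p -> R) :
  'I_n -> R := fun i => \sum_j X i j * b j.

(* sorted_abs u j = |u|_(j+1): j-th largest absolute value (0-indexed) *)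
Definition sorted_abs {R : realType} {m : nat} (u : 'I_m -> R) (j : nat) : R :=
  nth 0 (sort (fun a b : R => b <= a) [seq `|u i| | i <- enum 'I_m]) j.

Definition Jsort {R : realType} {m : nat} (lam : 'I_m -> R) (x : 'I_m -> R) : R :=
  \sum_(j < m) lam j * sorted_abs x j.

(* eps = (eps_1,...,eps_n) ~ N(0, sigma^2 I_n): each eps_i is measurable and the
   joint law is the product of N(0, sigma^2) laws (mutual independence with
   Gaussian marginals), stated on measurable rectangles. *)
Definition iid_gaussian {R : realType} (d : measure_display) (T : measurableType d)
  (P : probability T R) (n : nat) (eps : 'I_n -> T -> R) (sigma : R) : Prop :=
  (forall i, measurable_fun [set: T] (eps i)) /\
  forall A : 'I_n -> set R, (forall i, measurable (A i)) ->
    P (\bigcap_(i in [set: 'I_n]) (eps i @^-1` A i)) =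
    (\prod_(i < n) normal_prob 0 sigma (A i))%E.

(* Main.v *)
Require Import Defs.
From HB Require Import structures.
From mathcomp Require Import all_boot all_order all_algebra fingroup perm.
From mathcomp Require Import all_classical all_reals all_analysis measurable_realfun.
From mathcomp Require Import ring lra.

(* Write [hb], [hm] for the errors of the estimator in [beta] and [mu].

   Deterministic part. First-order optimality along the segment from the
   minimiser to the truth gives
     |X hb + hm|^2 <= <eps, X hb + hm> + nu (|betastar|_1 - |betahat|_1)
                      + rho (J(mustar) - J(muhat)).
   On the event that |X^T eps|_oo <= nu / 2 and that, for every index set I with
   |I| >= s, the sum of eps_i^2 over I is at most (80 / 3) sigma^2 |I| ln (2 n / |I|),
   the sorted noise satisfies |eps|_(j) <= (rho / 2) lambda_j for j >= s and its
   s largest entries have norm at most (rho / 2) Lam, where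
   Lam^2 = lambda_1^2 + ... + lambda_s^2. The right-hand side is then at most
   (3 / 2) nu sqrt k |hb|_2 + (3 / 2) rho Lam |hm|_2, and dropping the left-hand
   side instead shows that (hb, hm) lies in the cone of the restricted
   eigenvalue condition, where |X hb + hm|^2 >= kappa^2 (|hb|^2 + |hm|^2).

   Probabilistic part. A union bound with the two-sided tail
   P(|<x, eps>| > t sigma) <= exp (- t^2 / 2) for unit x, whose constant 1 comes
   from a change of measure, controls X^T eps up to probability 1 / p. A second
   union bound over all I, with E exp (3 eps_i^2 / (8 sigma^2)) = 2 and
   'C(n, m) <= (e n / m)^m, costs (s / 2n)^s / 2. *)

Set Implicit Arguments. Unset Strict Implicit. Unset Printing Implicit Defensive.
Import Order.TTheory GRing.Theory Num.Theory.
Local Open Scope classical_set_scope.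
Local Open Scope ring_scope.

(** * Densities and one-dimensional Gaussian integrals *)

Section Density.
Local Open Scope ereal_scope.
Context d1 d2 (X : measurableType d1) (Y : measurableType d2) (R : realType).
Variables (phi : X -> Y) (mphi : measurable_fun setT phi).
Variables (mu : {measure set X -> \bar R}) (nu : {measure set Y -> \bar R}).
Variables (g : X -> R) (mg : measurable_fun setT g) (g0 : forall x, (0 <= g x)%R).
Hypothesis nuE : forall A, measurable A ->
  nu A = \int[mu]_x (\1_A (phi x) * g x)%:E.

Import HBNNSimple.

(** [nuE] describes the image under [phi] of the measure with density [g], tested on indicators;
    linearity extends it to simple functions and monotone convergence along [nnsfun_approx] to the
    rest. It serves with [phi] the identity for normal laws, and with [phi] a noise coordinate for
    independence. *)
Lemma ge0_integral_density (f : Y -> R) :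
  measurable_fun setT f -> (forall y, (0 <= f y)%R) ->
  \int[nu]_y (f y)%:E = \int[mu]_x (f (phi x) * g x)%:E.
Proof.
move=> mf f0.
pose fE : Y -> \bar R := fun y => (f y)%:E.
have mf' : measurable_fun setT fE by exact/measurable_EFinP.
have f0' : forall y, setT y -> 0 <= fE y by move=> y _; rewrite lee_fin.
pose f_ := nnsfun_approx measurableT mf'.
have mfphi n : measurable_fun setT (fun x => (f_ n (phi x) * g x)%:E).
  by apply/measurable_EFinP/measurable_funM => //; exact: measurableT_comp.
have m1 (k : R) n : measurable_fun setT (\1_(f_ n @^-1` [set k]) \o phi : X -> R).
  by apply: measurableT_comp.
transitivity (limn (fun n => \int[nu]_x (f_ n x)%:E)).
  rewrite -monotone_convergence//.
  - apply: eq_integral => y _; apply/esym/cvg_lim => //.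
    exact: cvg_nnsfun_approx.
  - by move=> n; exact/measurable_EFinP/measurable_funP.
  - by move=> n y _; rewrite lee_fin.
  - by move=> y _ m n mn; rewrite lee_fin; exact/lefP/nd_nnsfun_approx.
rewrite [X in limn X](_ : _ = (fun n => \int[mu]_x (f_ n (phi x) * g x)%:E)).
  rewrite -monotone_convergence//; last 2 first.
    - by move=> n x _ /=; rewrite lee_fin mulr_ge0.
    - move=> x _ m n mn; rewrite lee_fin ler_wpM2r//.
      exact/lefP/nd_nnsfun_approx.
  apply: eq_integral => x _ /=; apply/cvg_lim => //.
  under eq_fun do rewrite EFinM muleC.
  rewrite EFinM muleC; apply: cvgeZl => //.
  exact: (cvg_nnsfun_approx measurableT mf' f0').
apply/funext => n.
under eq_integral do rewrite fimfunE -fsumEFin//.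
rewrite ge0_integral_fsum//; last 2 first.
- by move=> y; exact/measurable_EFinP/measurable_funM.
- by move=> y x _; rewrite nnfun_muleindic_ge0.
transitivity (\sum_(k \in range (f_ n))
    \int[mu]_x (k * (\1_(f_ n @^-1` [set k]) (phi x) * g x))%:E).
  apply: eq_fsbigr => r; rewrite inE => -[y _ <-].
  rewrite integralZl_indic_nnsfun// integral_indic//= setIT nuE//.
  under [RHS]eq_integral do rewrite EFinM.
  rewrite ge0_integralZl_EFin//.
  - by move=> x _; rewrite lee_fin mulr_ge0.
  - by apply/measurable_EFinP/measurable_funM => //; exact: m1.
rewrite -ge0_integral_fsum//.
- apply: eq_integral => x _; rewrite fsumEFin// [in RHS]fimfunE.
  rewrite !fsbig_finite//= mulr_suml.
  by congr EFin; apply: eq_bigr => r _; rewrite mulrA.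
- move=> r; apply/measurable_EFinP/measurable_funM => //.
  by apply: measurable_funM => //; exact: m1.
- move=> r x _; rewrite lee_fin mulrA mulr_ge0//.
  by have := nnfun_muleindic_ge0 (f_ n) r (phi x); rewrite lee_fin.
Qed.

End Density.

Section NormalFacts.
Context {R : realType}.
Local Notation mu := (@lebesgue_measure R).
Local Open Scope ereal_scope.

Lemma ge0_integral_normal_prob (m s : R) (f : R -> R) :
  measurable_fun setT f -> (forall y, (0 <= f y)%R) ->
  \int[normal_prob m s]_y (f y)%:E = \int[mu]_x (f x * normal_pdf m s x)%:E.
Proof.
move=> mf f0.
apply: (@ge0_integral_density _ _ (measurableTypeR R) (measurableTypeR R) R idfun
  (@measurable_id _ _ setT) mu (normal_prob m s) (normal_pdf m s)) => //.
- exact: measurable_normal_pdf.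
- exact: normal_pdf_ge0.
- move=> A mA; rewrite [LHS]integral_mkcond.
  apply: eq_integral => x _; rewrite /restrict indicE.
  by case: ifP; rewrite ?mul1r ?mul0r.
Qed.

Lemma lebesgue_measure_shift (a : R) (A : set R) : measurable A ->
  pushforward mu ((fun z => z - a)%R : _ -> measurableTypeR R) A = mu A.
Proof.
have mf : measurable_fun setT ((fun z => z - a)%R : measurableTypeR R -> measurableTypeR R).
  by apply: measurable_funB.
move=> mA; apply/esym/lebesgue_measure_unique => //=.
move=> _ [[x y]] _ <-.
rewrite /pushforward.
rewrite (_ : _ @^-1` _ = `](x + a)%R, (y + a)%R]%classic); last first.
  by apply/seteqP; split => z /=; rewrite !in_itv/= ltrBrDr lerBlDr.
rewrite !lebesgue_measure_itv/= !lte_fin ltrD2r; case: ifP => // _.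
by rewrite -!EFinB; congr EFin; ring.
Qed.

Lemma normal_prob_shift (s a : R) (A : set R) : s != 0%R -> measurable A ->
  normal_prob 0 s ((fun z => z - a)%R @^-1` A) = normal_prob (- a)%R s A.
Proof.
move=> s0 mA; rewrite /normal_prob.
have mf : measurable_fun setT
    ((fun z => z - a)%R : measurableTypeR R -> measurableTypeR R).
  by apply: measurable_funB.
rewrite -[RHS](@eq_measure_integral _ (measurableTypeR R) _ _ mu
  (pushforward mu ((fun z => z - a)%R : measurableTypeR R -> measurableTypeR R))); last first.
  by move=> B mB _; exact: lebesgue_measure_shift.
rewrite [RHS]ge0_integral_pushforward//=.
- apply: eq_integral => x _; rewrite !normal_pdfE// /normal_fun.
  by rewrite opprK subrK subr0.
- apply/measurable_EFinP/measurable_funTS; exact: measurable_normal_pdf.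
- by move=> y _; rewrite lee_fin normal_pdf_ge0.
Qed.

(* The Gaussian tilt by [3 / 8] of the square is twice the density of [N(0, (2 s)^2)]. *)
Lemma integral_normal_expR_sqr (s : R) : s != 0%R ->
  \int[normal_prob 0 s]_x (expR (3 / 8 * (x / s) ^+ 2))%:E = 2%:E.
Proof.
move=> s0.
have s20 : (2 * s != 0)%R by rewrite mulf_neq0.
rewrite ge0_integral_normal_prob//; last first.
  apply: measurableT_comp => //; apply: measurable_funM => //.
  by apply: measurable_funX; apply: measurable_funM.
transitivity (\int[mu]_x (2%:E * (normal_pdf 0 (2 * s) x)%:E)).
  apply: eq_integral => x _; rewrite !normal_pdfE// -EFinM; congr EFin.
  rewrite /normal_peak /normal_fun.
  (* Doubling the standard deviation halves the peak of the density, hence the factor 2; in the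
     exponent, 3/8 - 1/2 = -1/8. *)
  have -> : ((2 * s) ^+ 2 * pi *+ 2 = 2 ^+ 2 * (s ^+ 2 * pi *+ 2))%R by ring.
  rewrite sqrtrM ?sqr_ge0// sqrtr_sqr ger0_norm// invfM.
  rewrite [RHS]mulrA mulVKf// mulrCA -expRD.
  have -> : (3 / 8 * (x / s) ^+ 2 + - (x - 0) ^+ 2 / (s ^+ 2 *+ 2) =
    - (x - 0) ^+ 2 / ((2 * s) ^+ 2 *+ 2))%R by field; rewrite s0.
  by [].
rewrite ge0_integralZl_EFin//.
- by rewrite integral_normal_pdf mule1.
- by move=> x _; rewrite lee_fin normal_pdf_ge0.
- by apply/measurable_EFinP; exact: measurable_normal_pdf.
Qed.

(** Completing the square turns the tilted centred density into that of [N(- a, s^2)]: the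
    one-dimensional Cameron-Martin formula. *)
Lemma integral_normal_tilt (s a : R) (A : set R) : s != 0%R -> measurable A ->
  \int[normal_prob 0 s]_x
    (expR (- (a * x) / s ^+ 2 - a ^+ 2 / (2 * s ^+ 2)) * \1_A x)%:E =
  normal_prob (- a)%R s A.
Proof.
move=> s0 mA; rewrite ge0_integral_normal_prob//; last first.
  apply: measurable_funM => //; apply: measurableT_comp => //.
  apply: measurable_funB => //; apply: measurable_funM => //.
  by apply: measurableT_comp => //; apply: measurable_funM.
rewrite /normal_prob [RHS]integral_mkcond; apply: eq_integral => x _.
rewrite /restrict indicE; case: ifP => _; rewrite ?mulr1 ?mulr0 ?mul0r//.
rewrite !normal_pdfE// /normal_fun mulrCA -expRD.
set e1 := (X in expR X); set e2 := (X in _ = (_ * expR X)%:E).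
by have -> : e1 = e2 by rewrite /e1 /e2; field; rewrite s0.
Qed.

End NormalFacts.

(** * Independence *)

Section Independence.
Local Open Scope ereal_scope.
Context {R : realType} {d : measure_display} {T : measurableType d}.
Variables (P : probability T R) (n : nat) (eps : 'I_n -> T -> R) (sigma : R).
Hypothesis iid : iid_gaussian P eps sigma.

Let N : probability _ R := normal_prob 0 sigma.

Lemma prod_indic_bigcap (A : 'I_n -> set R) w :
  (\prod_(i < n) \1_(A i) (eps i w))%R =
  \1_(\bigcap_(i in [set: 'I_n]) (eps i @^-1` A i)) w :> R.
Proof.
have [h|h] := pselect ((\bigcap_(i in [set: 'I_n]) (eps i @^-1` A i)) w).
  rewrite [RHS]indicE mem_set// big1// => i _.
  by rewrite indicE mem_set//; exact: h.
rewrite [RHS]indicE memNset//.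
have [i hi] : exists i, ~ A i (eps i w).
  by apply/existsNP => h'; apply: h => i _; exact: h'.
by rewrite (bigD1 i)//= indicE memNset// mul0r.
Qed.

(* Indicators are replaced by general functions one index at a time: once the
   other factors are frozen, both sides are measures in the set attached to that
   index. *)
Let expectation_prod_rec (l : seq 'I_n) (g : 'I_n -> R -> R) : uniq l ->
  (forall i, measurable_fun setT (g i)) -> (forall i x, (0 <= g i x)%R) ->
  (forall i, \int[N]_x (g i x)%:E < +oo) ->
  (forall i, i \notin l -> exists2 A, measurable A & g i = \1_A) ->
  \int[P]_w (\prod_(i < n) g i (eps i w))%:E = \prod_(i < n) \int[N]_x (g i x)%:E.
Proof.
have [meps prodP] := iid.
elim: l g => [|j l IH] g ul mg g0 gfin gl.
  (* When every factor is an indicator, the product is the indicator of a rectangle, where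
     independence is assumed. *)
  have /choice[A hA] : forall i, exists A, measurable A /\ g i = \1_A.
    by move=> i; have [//|B mB ->] := gl i; exists B.
  under eq_integral do
    (under eq_bigr do rewrite (hA _).2); rewrite /=.
  under eq_integral do rewrite prod_indic_bigcap.
  rewrite integral_indic//=; last first.
    apply: fin_bigcap_measurable => // i _.
    by rewrite -[X in measurable X]setTI; apply: meps => //; exact: (hA i).1.
  rewrite setIT prodP; last by move=> i; exact: (hA i).1.
  apply: eq_bigr => i _; rewrite (hA i).2 integral_indic ?setIT//; exact: (hA i).1.
pose c := \prod_(i < n | i != j) \int[N]_x (g i x)%:E.
have c0 : 0 <= c by apply: prode_ge0 => i _; apply: integral_ge0 => x _; rewrite lee_fin.
have cfin : c \is a fin_num.
  rewrite /c; elim/big_ind: _ => //; first by move=> x y; exact: fin_numM.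
  move=> i _; rewrite ge0_fin_numE//.
  by apply: integral_ge0 => x _; rewrite lee_fin.
have fc0 : (0 <= fine c)%R by exact: fine_ge0.
pose G w := (\prod_(i < n | i != j) g i (eps i w))%R.
have mG : measurable_fun setT G.
  have -> : G = fun w => (\prod_(i < n) (if i != j then g i (eps i w) else 1))%R.
    by apply/funext => w; exact: big_mkcond.
  apply: measurable_prod => i _; case: (i != j) => //.
  exact: measurableT_comp.
have G0 w : (0 <= G w)%R by apply: prodr_ge0.
pose nu := mscale (NngNum fc0) N.
have nuE A : measurable A -> nu A = \int[P]_w (\1_A (eps j w) * G w)%:E.
  move=> mA; pose g' i := if i == j then \1_A else g i.
  transitivity (\int[P]_w (\prod_(i < n) g' i (eps i w))%:E); last first.
    apply: eq_integral => w _; rewrite (bigD1 j)//= /g' eqxx; congr (_ * _)%:E.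
    by apply: eq_bigr => i /negbTE ->.
  rewrite IH; first last.
  - move=> i il; rewrite /g'; case: eqP => [_|/eqP ij]; first by exists A.
    by apply: gl; rewrite inE negb_or ij.
  - move=> i; rewrite /g'; case: ifP => // _.
    by rewrite integral_indic// setIT (le_lt_trans (probability_le1 _ _))// ltry.
  - by move=> i x; rewrite /g'; case: ifP.
  - by move=> i; rewrite /g'; case: ifP.
  - by case/andP: ul.
  rewrite (bigD1 j)//= /g' eqxx integral_indic// setIT /nu /mscale/= fineK// muleC.
  by congr (_ * _); apply: eq_bigr => i /negbTE ->.
transitivity (\int[P]_w (g j (eps j w) * G w)%:E).
  by apply: eq_integral => w _; rewrite (bigD1 j).
rewrite -(@ge0_integral_density _ _ T (measurableTypeR R) R (eps j) (meps j) P nu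
  G mG G0 nuE (g j) (mg j) (g0 j)).
rewrite ge0_integral_mscale//=; first by rewrite fineK// (bigD1 j)//= muleC.
- by apply/measurable_EFinP; exact: mg.
- by move=> x _; rewrite lee_fin.
Qed.

Lemma expectation_prod (g : 'I_n -> R -> R) :
  (forall i, measurable_fun setT (g i)) -> (forall i x, (0 <= g i x)%R) ->
  (forall i, \int[N]_x (g i x)%:E < +oo) ->
  \int[P]_w (\prod_(i < n) g i (eps i w))%:E = \prod_(i < n) \int[N]_x (g i x)%:E.
Proof.
move=> mg g0 gfin; apply: (@expectation_prod_rec (enum 'I_n)) => //.
- exact: enum_uniq.
- by move=> i; rewrite mem_enum.
Qed.

End Independence.

(** * Tails of Gaussian linear forms *)

(** Named so that it can be registered below as a measure, which lets uniqueness on a generating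
    pi-system apply to it. *)
Definition mdensity {d} {T : measurableType d} {R : realType}
    (mu : set T -> \bar R) (f : T -> R) (A : set T) : \bar R :=
  (\int[mu]_(x in A) (f x)%:E)%E.

Section MDensity.
Local Open Scope ereal_scope.
Context {d} {T : measurableType d} {R : realType} (mu : {measure set T -> \bar R}).
Variables (f : T -> R) (mf : measurable_fun setT f) (f0 : forall x, (0 <= f x)%R).

Lemma mdensity0 : mdensity mu f set0 = 0.
Proof. exact: integral_set0. Qed.

Lemma mdensity_ge0 A : 0 <= mdensity mu f A.
Proof. by apply: integral_ge0 => x _; rewrite lee_fin. Qed.

Lemma mdensity_sigma_additive : semi_sigma_additive (mdensity mu f).
Proof.
move=> A mA tA mUA; rewrite /mdensity ge0_integral_bigcup//.
- apply: is_cvg_ereal_nneg_natsum_cond => n _ _.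
  by apply: integral_ge0 => x _; rewrite lee_fin.
- by apply: measurable_funTS; exact/measurable_EFinP.
- by move=> x _; rewrite lee_fin.
Qed.

HB.instance Definition _ := isMeasure.Build _ _ _
  (mdensity mu f) mdensity0 mdensity_ge0 mdensity_sigma_additive.

End MDensity.

(* Alias: canonical inference does not see the pointed structure of a bare arrow type. *)
Definition vec (R : realType) (n : nat) := 'I_n -> R.
HB.instance Definition _ R n := gen_eqMixin (vec R n).
HB.instance Definition _ R n := gen_choiceMixin (vec R n).
HB.instance Definition _ R n := isPointed.Build (vec R n) (fun=> 0).

(** The pi-system on which [iid_gaussian] prescribes the joint law; it generates the sigma-algebra
    used on [vec R n]. *)
Definition rectangles {R : realType} {n : nat} : set (set (vec R n)) :=
  [set B | exists2 A : 'I_n -> set R,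
     (forall i, measurable (A i)) & B = [set z | forall i, A i (z i)]].

Section LinearTail.
Local Open Scope ereal_scope.
Context {R : realType} {d : measure_display} {T : measurableType d}.
Variables (P : probability T R) (n : nat) (eps : 'I_n -> T -> R) (sigma : R).
Hypothesis iid : iid_gaussian P eps sigma.
Hypothesis sigma0 : (0 < sigma)%R.

Let E := g_sigma_algebraType (@rectangles R n).

Lemma rectanglesI : setI_closed (@rectangles R n).
Proof.
move=> _ _ [A mA ->] [B mB ->]; exists (fun i => A i `&` B i).
  by move=> i; exact: measurableI.
apply/seteqP; split => z /=; first by move=> [hA hB] i; split; [exact: hA|exact: hB].
by move=> h; split => i; have [] := h i.
Qed.

Lemma measurable_coordinate i : measurable_fun setT (fun z : E => z i).
Proof.
move=> _ A mA; rewrite setTI; apply: sub_sigma_algebra.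
exists (fun j => if j == i then A else setT); first by move=> j; case: ifP.
apply/seteqP; split => z /=; first by move=> h j; case: ifP => // /eqP ->.
by move=> /(_ i); rewrite eqxx.
Qed.

Lemma measurable_vector (phi : 'I_n -> T -> R) :
  (forall i, measurable_fun setT (phi i)) ->
  measurable_fun setT (fun w => phi^~ w : E).
Proof.
move=> mphi; apply: (@measurability _ _ T E setT _ (@rectangles R n)) => //.
move=> _ [B [A mA ->] <-]; rewrite setTI.
rewrite (_ : _ @^-1` _ = \bigcap_(i in [set: 'I_n]) (phi i @^-1` A i)).
  apply: fin_bigcap_measurable => // i _.
  by rewrite -[X in measurable X]setTI; exact: mphi.
by apply/seteqP; split => w /= h i; [move=> _; exact: h|exact: h].
Qed.

Let S (x : 'I_n -> R) w : R := (\sum_i x i * eps i w)%R.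

Lemma measurable_lincomb x : measurable_fun setT (S x).
Proof.
apply: measurable_sum => i; apply: measurable_funM => //; exact: (iid.1 i).
Qed.

(* Translating the noise by [- t sigma x] multiplies its law by the density
   [expR (- t <x, eps> / sigma - t^2 / 2)], which is at most [expR (- t^2 / 2)]
   on the half space [<x, eps> > 0]. *)
Lemma gaussian_tail_halfspace (x : 'I_n -> R) (t : R) : (0 <= t)%R ->
  (\sum_i x i ^+ 2 = 1)%R ->
  P [set w | t * sigma < S x w]%R <=
  (expR (- t ^+ 2 / 2))%:E * P [set w | 0 < S x w]%R.
Proof.
move=> t0 x1; have [meps prodP] := iid.
have s0 : sigma != 0%R by rewrite gt_eqF.
pose a i := (t * sigma * x i)%R.
pose W w := (\prod_(i < n)
   expR (- (a i * eps i w) / sigma ^+ 2 - a i ^+ 2 / (2 * sigma ^+ 2)))%R.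
have WE w : W w = expR (- t * S x w / sigma - t ^+ 2 / 2).
  rewrite /W -expR_sum; congr expR.
  rewrite sumrB -!mulr_suml sumrN /S; congr (_ - _)%R.
    rewrite mulr_sumr -sumrN !mulr_suml; apply: eq_bigr => i _.
    by rewrite /a; field.
  rewrite (_ : (\sum_i a i ^+ 2 = t ^+ 2 * sigma ^+ 2)%R); first by field.
  rewrite -[RHS]mulr1 -x1 mulr_sumr; apply: eq_bigr => i _.
  by rewrite /a; ring.
have mh i (B : set R) : measurable B -> measurable_fun setT (fun y =>
   expR (- (a i * y) / sigma ^+ 2 - a i ^+ 2 / (2 * sigma ^+ 2)) * \1_B y)%R.
  move=> mB; apply: measurable_funM => //; apply: measurableT_comp => //.
  apply: measurable_funB => //; apply: measurable_funM => //.
  by apply: measurableT_comp => //; apply: measurable_funM.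
have mW : measurable_fun setT W.
  rewrite (_ : W = fun w => expR (- t * S x w / sigma - t ^+ 2 / 2)); last exact/funext.
  apply: measurableT_comp => //; apply: measurable_funB => //.
  apply: measurable_funM => //; apply: measurable_funM => //.
  exact: measurable_lincomb.
have W0 w : (0 <= W w)%R by rewrite WE expR_ge0.
pose phi w : E := fun i => (eps i w - a i)%R.
pose psi w : E := eps^~ w.
have mphi : measurable_fun setT phi.
  by apply: measurable_vector => i; apply: measurable_funB.
have mpsi : measurable_fun setT psi by exact: measurable_vector.
pose m1 : {measure set E -> \bar R} := pushforward P phi.
pose m2 : {measure set E -> \bar R} := pushforward (mdensity P W) psi.
(* [m1] is the law of the translated noise and [m2] the law of the noise under the density [W]. On a
   rectangle both are the product of the [N(- a i, sigma^2)] probabilities of its sides, hence they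
   coincide. *)
have m12 B : measurable B -> m1 mphi B = m2 mW W0 mpsi B.
  apply: (@measure_unique _ R E (@rectangles R n) (fun=> setT)) => //.
  - exact: rectanglesI.
  - by move=> _; exists (fun=> setT) => //; apply/seteqP.
  - by rewrite bigcup_const.
  - move=> _ [A mA ->]; rewrite /m1 /m2 /= /pushforward /mdensity.
    rewrite (_ : phi @^-1` _ = \bigcap_(i in [set: 'I_n])
      (eps i @^-1` ((fun z => z - a i)%R @^-1` A i))); last first.
      by apply/seteqP; split => w /= h i; [move=> _; exact: h|exact: h].
    rewrite prodP; last first.
      move=> i; rewrite -[X in measurable X]setTI.
      have mf : measurable_fun setT (fun z : R => z - a i)%R by apply: measurable_funB.
      exact: mf.
    rewrite integral_mkcond.
    transitivity (\int[P]_w (\prod_(i < n) (fun y =>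
       expR (- (a i * y) / sigma ^+ 2 - a i ^+ 2 / (2 * sigma ^+ 2)) *
       \1_(A i) y) (eps i w))%:E).
      rewrite (expectation_prod iid (g := fun i y => expR (- (a i * y) / sigma ^+ 2 -
        a i ^+ 2 / (2 * sigma ^+ 2)) * \1_(A i) y)%R)//.
      - apply: eq_bigr => i _; rewrite normal_prob_shift//.
        by rewrite integral_normal_tilt.
      - by move=> i; exact: mh.
      - move=> i; rewrite integral_normal_tilt//.
        apply: (@le_lt_trans _ _ 1); last exact: ltry.
        exact: (@probability_le1 _ _ _ (normal_prob (- a i) sigma)%R _ (mA i)).
    apply: eq_integral => w _ /=.
    rewrite big_split/= prod_indic_bigcap -/(W w) /restrict.
    rewrite (_ : psi @^-1` _ = \bigcap_(i in [set: 'I_n]) (eps i @^-1` A i)); last first.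
      by apply/seteqP; split => z /= h i; [move=> _; exact: h|exact: h].
    by rewrite indicE; case: ifP; rewrite ?mulr1 ?mulr0.
  - by move=> _; rewrite /m1/= /pushforward preimage_setT probability_setT ltry.
pose H : set E := [set z | (0 < \sum_i x i * z i)%R].
have mH : measurable H.
  have mf : measurable_fun setT (fun z : E => \sum_i x i * z i)%R.
    apply: measurable_sum => i; apply: measurable_funM => //.
    exact: measurable_coordinate.
  have := mf measurableT _ (measurable_itv `]0%R, +oo[).
  rewrite setTI (_ : _ @^-1` _ = H)//.
  by apply/seteqP; split => z /=; rewrite in_itv/= andbT.
have := m12 _ mH; rewrite /m1 /m2 /= /pushforward /mdensity.
rewrite (_ : phi @^-1` H = [set w | t * sigma < S x w]%R); last first.
  (* Since [x] has unit norm, translating by [a] lowers [S x] by exactly [t * sigma]. *)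
  have e w : (\sum_i x i * phi w i = S x w - t * sigma)%R.
    rewrite /phi /S -[(t * sigma)%R]mulr1 -x1 mulr_sumr -sumrB.
    by apply: eq_bigr => i _; rewrite /a; ring.
  by apply/seteqP; split => w; rewrite /H/= e subr_gt0.
move=> ->; rewrite -(_ : psi @^-1` H = [set w | 0 < S x w]%R)//.
have mpH : measurable (psi @^-1` H) by rewrite -[X in measurable X]setTI; exact: (mpsi measurableT _ mH).
rewrite -integral_cst//; apply: ge0_le_integral => //.
- by move=> w _; rewrite lee_fin.
- by apply: measurable_funTS; exact/measurable_EFinP.
- move=> w Hw; rewrite lee_fin WE ler_expR.
  suff : (0 <= t * S x w / sigma)%R by lra.
  by rewrite !mulr_ge0// ?invr_ge0 ltW.
Qed.

(** The two tails are compared with the half spaces [S x > 0] and [S x < 0]. These are disjoint, so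
    their probabilities sum to at most 1 and no factor 2 appears. *)
Lemma gaussian_tail (x : 'I_n -> R) (t : R) : (0 <= t)%R ->
  (\sum_i x i ^+ 2 = 1)%R ->
  P [set w | t * sigma < `|S x w|]%R <= (expR (- t ^+ 2 / 2))%:E.
Proof.
move=> t0 x1.
have mS c y : measurable [set w | (c < S y w)%R].
  have := measurable_lincomb y measurableT (measurable_itv `]c, +oo[).
  rewrite setTI (_ : _ @^-1` _ = [set w | (c < S y w)%R])//.
  by apply/seteqP; split => z /=; rewrite in_itv/= andbT.
pose x' i := (- x i)%R.
have Sx' w : (S x' w = - S x w)%R.
  by rewrite /S -sumrN; apply: eq_bigr => i _; rewrite mulNr.
have x'1 : (\sum_i x' i ^+ 2 = 1)%R.
  by rewrite -x1; apply: eq_bigr => i _; rewrite sqrrN.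
have -> : [set w | t * sigma < `|S x w|]%R =
    [set w | t * sigma < S x w]%R `|` [set w | t * sigma < S x' w]%R.
  apply/seteqP; split => w /=; rewrite Sx' lter_normr; first by move/orP.
  by move=> ?; apply/orP.
apply: le_trans (measureU2 _ (mS _ _) (mS _ _)) _.
apply: le_trans (leeD (gaussian_tail_halfspace t0 x1) (gaussian_tail_halfspace t0 x'1)) _.
rewrite -ge0_muleDr//.
rewrite -[leRHS]mule1; apply: lee_wpmul2l; first by rewrite lee_fin expR_ge0.
rewrite -measureU//; first exact/probability_le1/measurableU.
apply/seteqP; split => w //= -[]; rewrite Sx'; lra.
Qed.

End LinearTail.

(** * Chi-square tails and the union bound over supports *)

Lemma probability_bigsetU_le {R : realType} {d} {T : measurableType d}
    (P : probability T R) (I : Type) (r : seq I) (Q : pred I) (F : I -> set T) (c : I -> R) :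
  (forall i, Q i -> measurable (F i)) -> (forall i, Q i -> (P (F i) <= (c i)%:E)%E) ->
  (P (\big[setU/set0]_(i <- r | Q i) F i) <= (\sum_(i <- r | Q i) c i)%:E)%E.
Proof.
move=> mF PF.
suff [] : measurable (\big[setU/set0]_(i <- r | Q i) F i) /\
  (P (\big[setU/set0]_(i <- r | Q i) F i) <= (\sum_(i <- r | Q i) c i)%:E)%E by [].
elim/big_rec2: _ => [|i x A Qi [mA PA]]; first by rewrite measure0.
split; first by apply: measurableU => //; exact: mF.
rewrite EFinD; apply: le_trans (measureU2 _ (mF _ Qi) mA) _.
by apply: leeD => //; exact: PF.
Qed.

Section ChiSquareTail.
Context {R : realType} {d : measure_display} {T : measurableType d}.
Variables (P : probability T R) (n : nat) (eps : 'I_n -> T -> R) (sigma : R).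
Hypothesis iid : iid_gaussian P eps sigma.
Hypothesis sigma0 : 0 < sigma.

Let Z (I : {set 'I_n}) w : R := \sum_(i in I) (eps i w / sigma) ^+ 2.

Lemma measurable_chi_square I : measurable_fun setT (Z I).
Proof.
rewrite (_ : Z I = fun w => \sum_i (if i \in I then (eps i w / sigma) ^+ 2 else 0)).
  apply: measurable_sum => i; case: (i \in I) => //.
  by apply: measurable_funX; apply: measurable_funM => //; exact: (iid.1 i).
by apply/funext => w; rewrite /Z big_mkcond.
Qed.

Lemma measurable_chi_square_gt I c : measurable [set w | c < Z I w].
Proof.
have := measurable_chi_square I measurableT (measurable_itv `]c, +oo[).
rewrite setTI (_ : _ @^-1` _ = [set w | (c < Z I w)%R])//.
by apply/seteqP; split => z /=; rewrite in_itv/= andbT.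
Qed.

(** Chernoff bound with exponent 3/8, for which each squared coordinate in [I] has exponential
    moment exactly 2. *)
Lemma chi_square_tail I c :
  (P [set w | (c < Z I w)%R] <= (2 ^+ #|I| * expR (- (3 / 8) * c))%:E)%E.
Proof.
have s0 : sigma != 0 by rewrite gt_eqF.
(* Coordinates outside [I] get the factor 1, so that [expectation_prod] applies to the full
   product. *)
pose g (i : 'I_n) (x : R) : R := if i \in I then expR (3 / 8 * (x / sigma) ^+ 2) else 1.
have mg i : measurable_fun setT (g i).
  rewrite /g; case: (i \in I) => //.
  apply: measurableT_comp => //; apply: measurable_funM => //.
  by apply: measurable_funX; apply: measurable_funM.
have g0 i x : 0 <= g i x by rewrite /g; case: ifP => // _; rewrite expR_ge0.
have gE i : (\int[normal_prob 0 sigma]_x (g i x)%:E = (if i \in I then 2 else 1)%:E)%E.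
  rewrite /g; case: (i \in I); first exact: integral_normal_expR_sqr.
  rewrite integral_cst// mul1e; exact: (@probability_setT _ _ _ (normal_prob 0 sigma)).
have gZ w : \prod_i g i (eps i w) = expR (3 / 8 * Z I w).
  rewrite /g /Z mulr_sumr expR_sum.
  by rewrite [RHS]big_mkcond.
rewrite -[P _]mul1e -integral_cst; last exact: measurable_chi_square_gt.
rewrite integral_mkcond.
apply: (@le_trans _ _ (\int[P]_w ((expR (- (3 / 8) * c))%:E *
    (\prod_(i < n) g i (eps i w))%:E))%E).
  apply: ge0_le_integral => //.
  - by move=> w _; rewrite /restrict; case: ifP.
  - apply/(measurable_restrictT _ _).1 => //; exact: measurable_chi_square_gt.
  - apply: measurable_funeM; apply/measurable_EFinP.
    apply: measurable_prod => i _; apply: (measurableT_comp (mg i)); exact: (iid.1 i).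
  - move=> w _; rewrite /restrict -EFinM gZ -expRD; case: ifP => [|_].
      rewrite inE/= => cZ; rewrite lee_fin -[leLHS]expR0 ler_expR; lra.
    by rewrite lee_fin expR_ge0.
rewrite ge0_integralZl_EFin ?expR_ge0//; last 2 first.
- by move=> w _; rewrite lee_fin prodr_ge0.
- apply/measurable_EFinP/measurable_prod => i _.
  apply: (measurableT_comp (mg i)); exact: (iid.1 i).
rewrite (expectation_prod iid)//; last by move=> i; rewrite gE ltry.
under eq_bigr do rewrite gE.
by rewrite prodEFin -EFinM lee_fin mulrC -big_mkcond/= prodr_const.
Qed.

End ChiSquareTail.

(** * Entropy of index sets and summation over supports *)

Section UnionBound.
Context {R : realType}.

(* With [lambda_m = sigma sqrt (ln (2 n / m))] this is [m lambda_m ^ 2 / sigma ^ 2]. *)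
Definition slope_entropy (n m : nat) : R := m%:R * ln ((2 * n)%:R / m%:R).

(** From [expR (- x) >= 1 - x] at [x = 2/25] comes [expR (2/25) <= 25/23]; the eighth power of 25/23
    is below 2. *)
Lemma ln2_ge : 16 / 25 <= ln (2 : R).
Proof.
rewrite -ler_expR lnK ?posrE//.
have -> : 16 / 25 = 8%:R * (2 / 25) :> R by lra.
rewrite expRM_natl.
have h : expR (2 / 25) <= (25 / 23 : R).
  have := expR_ge1Dx (- (2 / 25) : R); rewrite expRN.
  have := expR_gt0 (2 / 25 : R) => e0 h.
  rewrite -[X in X <= _]invrK -[X in _ <= X]invrK lef_pV2 ?posrE ?invr_gt0//; lra.
have : expR (2 / 25) ^+ 8 <= (25 / 23 : R) ^+ 8.
  by rewrite lerXn2r ?nnegrE ?expR_ge0//; lra.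
move=> /le_trans; apply; lra.
Qed.

Variables (n : nat).
Local Notation L := (slope_entropy n).

Lemma slope_entropy_ge m : (0 < m)%N -> (m <= n)%N -> m%:R * ln 2 <= L m.
Proof.
move=> m0 mn; have n0 : (0 < n)%N by exact: leq_trans mn.
rewrite /slope_entropy ler_wpM2l// ler_ln ?posrE ?divr_gt0 ?ltr0n ?muln_gt0//.
by rewrite ler_pdivlMr ?ltr0n// -natrM ler_nat leq_mul2l.
Qed.

Lemma slope_entropy_expR m : (0 < m)%N -> (m <= n)%N ->
  expR (- L m) = (m%:R / (2 * n)%:R) ^+ m.
Proof.
move=> m0 mn; have n0 : (0 < n)%N by exact: leq_trans mn.
have q0 : 0 < m%:R / (2 * n)%:R :> R by rewrite divr_gt0// ltr0n ?muln_gt0.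
rewrite /slope_entropy -mulrN -lnV ?posrE ?divr_gt0 ?ltr0n ?muln_gt0// invf_div.
by rewrite expRM_natl lnK// posrE.
Qed.

(** [L] need not be increasing. Factoring 2n/s as (2n/m)(m/s) leaves the defect s ln(m/s), at most m
    - s because ln x <= x - 1. *)
Lemma slope_entropy_le s m : (0 < s)%N -> (s <= m)%N -> (m <= n)%N -> L s <= L m + m%:R.
Proof.
move=> s0 sm mn; have m0 : (0 < m)%N by exact: leq_trans sm.
have n0 : (0 < n)%N by exact: leq_trans mn.
have sR : 0 < s%:R :> R by rewrite ltr0n.
have mR : 0 < m%:R :> R by rewrite ltr0n.
have nR : 0 < (2 * n)%:R :> R by rewrite ltr0n muln_gt0.
have -> : L s = s%:R * ln ((2 * n)%:R / m%:R) + s%:R * ln (m%:R / s%:R).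
  rewrite -mulrDr -lnM ?posrE ?divr_gt0//; congr (_ * ln _).
  by field; rewrite !gt_eqF.
apply: lerD.
  apply: ler_wpM2r; last by rewrite ler_nat.
  rewrite -ln1 ler_ln ?posrE ?divr_gt0// ler_pdivlMr// mul1r ler_nat.
  by rewrite (leq_trans mn)// leq_pmull.
have h : ln (m%:R / s%:R) <= m%:R / s%:R - 1 :> R.
  have := @le_ln1Dx R (m%:R / s%:R - 1); rewrite [1 + _]addrC subrK; apply.
  by rewrite ltrBrDl addrN divr_gt0.
have := ler_wpM2l (ltW sR) h; rewrite mulrBr mulrCA divff ?gt_eqF// mulr1.
by move=> /le_trans; apply; rewrite gerBl ?mulr1.
Qed.

(* [(m / n) ^ m] times the binomial is one term of [(1 + m / n) ^ n]. *)
Lemma bin_le_expR m : (0 < m)%N -> (m <= n)%N ->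
  'C(n, m)%:R * 2 ^+ m <= expR (m%:R + L m).
Proof.
move=> m0 mn; have n0 : (0 < n)%N by exact: leq_trans mn.
have mR : 0 < m%:R :> R by rewrite ltr0n.
have nR : 0 < n%:R :> R by rewrite ltr0n.
pose x : R := m%:R / n%:R.
have x0 : 0 < x by rewrite divr_gt0.
have h : 'C(n, m)%:R * x ^+ m <= expR m%:R.
  apply: (@le_trans _ _ ((1 + x) ^+ n)).
    rewrite exprDn (bigD1 (inord m))//= inordK ?ltnS// expr1n mul1r mulr_natl.
    rewrite lerDl sumr_ge0// => i _.
    by rewrite mulrn_wge0// mulr_ge0 ?exprn_ge0// ?ltW.
  apply: (@le_trans _ _ (expR x ^+ n)).
    by rewrite lerXn2r ?nnegrE ?expR_ge0 ?expR_ge1Dx ?addr_ge0// ltW.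
  by rewrite -expRM_natl /x mulrC divfK// gt_eqF.
rewrite expRD.
have -> : expR (L m) = 2 ^+ m / x ^+ m.
  rewrite -[L m]opprK expRN slope_entropy_expR// -exprVn -expr_div_n; congr (_ ^+ _).
  by rewrite /x natrM; field; rewrite !gt_eqF.
by rewrite [leLHS]mulrC [leRHS]mulrCA ler_wpM2l ?exprn_ge0// ler_pdivlMr ?exprn_gt0.
Qed.

(** The binomial and [2 ^+ m] cost [m + L m] in the exponent. Trading one further [L m] for [L s]
    costs another [m]; the remaining [8 * L m], at least [8 * m * ln 2], pays for these and for a
    geometric factor that makes the sum over [m] converge. *)
Lemma bin_tail_le s m : (0 < s)%N -> (s <= m)%N -> (m <= n)%N ->
  'C(n, m)%:R * (2 ^+ m * expR (- 10 * L m)) <= expR (- L s) * 2^-1 ^+ m.+1.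
Proof.
move=> s0 sm mn; have m0 : (0 < m)%N by exact: leq_trans sm.
rewrite mulrA; apply: (@le_trans _ _ (expR (m%:R + L m) * expR (- 10 * L m))).
  by rewrite ler_wpM2r ?expR_ge0 ?bin_le_expR.
have -> : 2^-1 ^+ m.+1 = expR (- (m.+1%:R * ln 2)) :> R.
  by rewrite -mulrN -lnV ?posrE// expRM_natl lnK// posrE invr_gt0.
rewrite -!expRD ler_expR.
have := slope_entropy_le s0 sm mn; have := slope_entropy_ge m0 mn; have := ln2_ge.
have : 1 <= m%:R :> R by rewrite ler1n.
by rewrite -[m.+1%:R]natr1; nra.
Qed.

Lemma sum_half_pow_le s : (0 < s)%N ->
  \sum_(s <= m < n.+1) 2^-1 ^+ m.+1 <= 2^-1 :> R.
Proof.
move=> s0.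
(* The sum telescopes; [maxn s k] makes the formula correct for empty ranges too. *)
have h k : \sum_(s <= m < k) 2^-1 ^+ m.+1 <= 2^-1 ^+ s - 2^-1 ^+ (maxn s k) :> R.
  elim: k => [|k IH]; first by rewrite big_geq// maxn0 subrr.
  have [sk|ks] := leqP s k; last by rewrite big_geq// (maxn_idPl _)// subrr.
  rewrite big_nat_recr//=; move: IH.
  rewrite (maxn_idPr sk) (maxn_idPr (leqW sk)) => IH.
  by rewrite exprS in IH *; lra.
apply: le_trans (h _) _; apply: (@le_trans _ _ (2^-1 ^+ s)).
  by rewrite gerBl exprn_ge0.
by rewrite -[leRHS]expr1 ler_wiXn2l//; lra.
Qed.

(** Grouping the sets by cardinality leaves at most ['C(n, m)] equal terms for each [m], to which
    [bin_tail_le] and the geometric sum apply. For [s > n] the sum is empty. *)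
Lemma sum_subsets_tail_le s : (0 < s)%N ->
  \sum_(I : {set 'I_n} | (s <= #|I|)%N) 2 ^+ #|I| * expR (- 10 * L #|I|) <=
  2^-1 * (s%:R / (2 * n)%:R) ^+ s.
Proof.
move=> s0.
have [sn|ns] := leqP s n; last first.
  rewrite big1; first by rewrite mulr_ge0 ?exprn_ge0 ?divr_ge0.
  move=> I sI; have := max_card (mem I); rewrite card_ord => In.
  by move: (leq_trans ns (leq_trans sI In)); rewrite ltnn.
rewrite (partition_big (fun I : {set 'I_n} => (inord #|I| : 'I_n.+1))
  (fun m => (s <= m)%N))/=; last first.
  by move=> I; rewrite inordK// ltnS; have := max_card (mem I); rewrite card_ord.
apply: (@le_trans _ _ (\sum_(m < n.+1 | (s <= m)%N) expR (- L s) * 2^-1 ^+ m.+1)).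
  apply: ler_sum => m sm.
  apply: le_trans (bin_tail_le s0 sm (ltn_ord m)).
  rewrite (eq_bigr (fun=> 2 ^+ m * expR (- 10 * L m))); last first.
    move=> I /andP[_ /eqP <-]; rewrite inordK// ltnS.
    by have := max_card (mem I); rewrite card_ord.
  rewrite sumr_const -[leLHS]mulr_natl ler_wpM2r ?mulr_ge0 ?exprn_ge0 ?expR_ge0//.
  rewrite ler_nat -[X in 'C(X, _)](card_ord n) -card_draws.
  apply: subset_leq_card; apply/fintype.subsetP => I; rewrite !inE.
  move=> /andP[_ /eqP <-]; rewrite inordK// ltnS.
  by have := max_card (mem I); rewrite card_ord.
rewrite -mulr_sumr slope_entropy_expR// mulrC ler_wpM2r ?exprn_ge0 ?divr_ge0//.
rewrite -(big_mkord (fun m => (s <= m)%N) (fun m => 2^-1 ^+ m.+1)).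
apply: le_trans (sum_half_pow_le s0).
by rewrite [leRHS](big_nat_widenl s 0).
Qed.

End UnionBound.

(** * Sorted absolute values *)

(** The sum of the squares [(a i * B - b i * S) ^+ 2] equals [B * (A * B - S ^+ 2)]; if [B = 0],
    every [b i] in the sum vanishes. *)
Lemma cauchy_schwarz_sum (R : realFieldType) (I : eqType) (r : seq I) (Q : pred I) (a b : I -> R) :
  (\sum_(i <- r | Q i) a i * b i) ^+ 2 <=
  (\sum_(i <- r | Q i) a i ^+ 2) * (\sum_(i <- r | Q i) b i ^+ 2).
Proof.
set S := (X in X ^+ 2); set A := (X in _ <= X * _); set B := (X in _ <= _ * X).
have B0 : 0 <= B by apply: sumr_ge0 => i _; exact: sqr_ge0.
have : 0 <= \sum_(i <- r | Q i) (a i * B - b i * S) ^+ 2.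
  by apply: sumr_ge0 => i _; exact: sqr_ge0.
have -> : \sum_(i <- r | Q i) (a i * B - b i * S) ^+ 2 = B * (A * B - S ^+ 2).
  rewrite (eq_bigr (fun i => B ^+ 2 * a i ^+ 2 - 2 * B * S * (a i * b i) +
    S ^+ 2 * b i ^+ 2)); last by move=> i _; ring.
  by rewrite big_split sumrB/= -!mulr_sumr -/A -/B -/S; ring.
move: B0; rewrite le_eqVlt => /orP[/eqP B0 _|B0]; last first.
  by rewrite pmulr_rge0// subr_ge0.
rewrite -B0 mulr0 /S big_seq_cond big1 ?expr0n//= => i /andP[ir Qi].
have /eqP : b i ^+ 2 = 0.
  apply/eqP; rewrite eq_le sqr_ge0 andbT [leRHS]B0 /B.
  rewrite (big_rem i)//= Qi lerDl; apply: sumr_ge0 => j _; exact: sqr_ge0.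
by rewrite sqrf_eq0 => /eqP ->; rewrite mulr0.
Qed.

Lemma cauchy_schwarz_sqrt (R : rcfType) (I : eqType) (r : seq I) (Q : pred I) (a b : I -> R) :
  \sum_(i <- r | Q i) a i * b i <=
  Num.sqrt (\sum_(i <- r | Q i) a i ^+ 2) * Num.sqrt (\sum_(i <- r | Q i) b i ^+ 2).
Proof.
rewrite -sqrtrM; last by apply: sumr_ge0 => i _; exact: sqr_ge0.
apply: le_trans (ler_norm _) _; rewrite -sqrtr_sqr.
by rewrite ler_wsqrtr// cauchy_schwarz_sum.
Qed.

(* Abel summation. *)
Lemma sum_nonincr_weights_le (R : realFieldType) (N : nat) (lam a b : nat -> R) :
  (forall j, (j.+1 < N)%N -> lam j.+1 <= lam j) ->
  (forall j, (j < N)%N -> 0 <= lam j) ->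
  (forall k, (k <= N)%N -> \sum_(0 <= j < k) a j <= \sum_(0 <= j < k) b j) ->
  \sum_(0 <= j < N) lam j * a j <= \sum_(0 <= j < N) lam j * b j.
Proof.
move=> lamS lam0 ab.
pose c j := b j - a j.
have c0 k : (k <= N)%N -> 0 <= \sum_(0 <= j < k) c j.
  by move=> kN; rewrite sumrB subr_ge0; exact: ab.
(* Invariant of the summation: passing from [k] to [k.+1] only lowers the weight in front of a
   nonnegative partial sum. *)
suff h k : (k < N)%N ->
    lam k * \sum_(0 <= j < k.+1) c j <= \sum_(0 <= j < k.+1) lam j * c j.
  case: N lamS lam0 c0 h {ab} => [|N] lamS lam0 c0 h; first by rewrite !big_geq.
  rewrite -subr_ge0 -sumrB.
  under eq_bigr do rewrite -mulrBr.
  by apply: le_trans (h _ (ltnSn _)); rewrite mulr_ge0 ?lam0 ?c0.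
elim: k => [|k IH] kN; first by rewrite !big_nat1.
rewrite big_nat_recr//= [leRHS]big_nat_recr//= mulrDr lerD2r.
apply: le_trans (IH (ltnW kN)); rewrite ler_wpM2r ?lamS//.
by apply: c0; exact: ltnW.
Qed.

Lemma subset_of_card (T : finType) (A : {set T}) (r : nat) : (r <= #|A|)%N ->
  exists2 B : {set T}, B \subset A & #|B| = r.
Proof.
rewrite -bin_gt0 -cards_draws card_gt0 => /set0Pn[B].
by rewrite inE => /andP[BA /eqP Br]; exists B.
Qed.

Section SortedAbs.
Context {R : realType} {n : nat}.
Implicit Types u : 'I_n -> R.

Let T k u : R := \sum_(0 <= j < k) sorted_abs u j.

Lemma sorted_abs_perm u :
  exists pi : {perm 'I_n}, forall j : 'I_n, sorted_abs u j = `|u (pi j)|.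
Proof.
pose t := [tuple `|u i| | i < n].
have e : [seq `|u i| | i <- enum 'I_n] = t :> seq R.
  by [].
have : perm_eq (sort (fun a b : R => b <= a) [seq `|u i| | i <- enum 'I_n]) t.
  by rewrite perm_sort -e.
move=> /tuple_permP[pi hpi]; exists pi => j.
rewrite /sorted_abs hpi -tnth_nth tnth_mktuple.
by rewrite tnth_mktuple.
Qed.

Lemma sorted_abs_nonincr u i j : (i <= j)%N -> (j < n)%N ->
  sorted_abs u j <= sorted_abs u i.
Proof.
move=> ij jn; rewrite /sorted_abs.
set s := sort _ _.
have ss : size s = n by rewrite size_sort size_map size_enum_ord.
have tr : transitive (fun a b : R => b <= a) by move=> y x z yx zy; exact: le_trans zy yx.
have so : sorted (fun a b : R => b <= a) s by apply: sort_sorted => x y; exact: le_total.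
by apply: (sorted_leq_nth tr) => //; rewrite ?inE ?ss// (leq_ltn_trans ij).
Qed.

Lemma sorted_abs_ge0 u j : 0 <= sorted_abs u j.
Proof.
have [jn|nj] := ltnP j n.
  by have [pi /(_ (Ordinal jn)) /= ->] := sorted_abs_perm u.
by rewrite /sorted_abs nth_default// size_sort size_map size_enum_ord.
Qed.

Lemma sum_sorted_abs (F : R -> R) u :
  \sum_(0 <= j < n) F (sorted_abs u j) = \sum_i F `|u i|.
Proof.
have [pi hpi] := sorted_abs_perm u.
rewrite big_mkord [RHS](reindex_inj (@perm_inj _ pi)) /=.
by apply: eq_bigr => j _; rewrite hpi.
Qed.

(** One set of positions realises the [k] largest entries for every [F], so it serves for absolute
    values and for squares. *)
Lemma top_set u k : (k <= n)%N -> exists2 I : {set 'I_n}, #|I| = k &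
  forall F : R -> R, \sum_(i in I) F `|u i| = \sum_(0 <= j < k) F (sorted_abs u j).
Proof.
move=> kn; have [pi hpi] := sorted_abs_perm u.
pose K := [set j : 'I_n | (j < k)%N]%SET.
exists (pi @: K)%SET.
  rewrite card_imset; last exact: perm_inj.
  by rewrite /K cardsE -sum1_card -(big_ord_widen n (fun=> 1%N))// sum_nat_const card_ord muln1.
move=> F; rewrite big_imset/=; last by move=> x y _ _; exact: perm_inj.
rewrite big_mkord (big_ord_widen n (fun j => F (sorted_abs u j)))//.
by apply: eq_big => [j|j _]; rewrite ?inE// hpi.
Qed.

(** With [c] the smallest of the top entries, [|u i| <= c + max (|u i| - c, 0)]. The positive parts
    of all entries add up to the top sum minus [c] times the number of top entries. *)
Lemma sum_le_top u k (I : {set 'I_n}) : (k <= n)%N -> (#|I| <= k)%N ->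
  \sum_(i in I) `|u i| <= T k u.
Proof.
case: k => [|k] kn Ik.
  move: Ik; rewrite leqn0 cards_eq0 => /eqP ->.
  by rewrite big_set0 /T big_geq.
pose c := sorted_abs u k; pose F (x : R) := Num.max (x - c) 0.
have c0 : 0 <= c by exact: sorted_abs_ge0.
apply: (@le_trans _ _ (c *+ #|I| + \sum_i F `|u i|)).
  rewrite -sumr_const (bigID (mem I) predT)/= addrA -big_split/=.
  rewrite ler_wpDr//; first by apply: sumr_ge0 => i _; rewrite le_max lexx orbT.
  by apply: ler_sum => i _; rewrite -lerBlDl le_max lexx.
rewrite -sum_sorted_abs (big_cat_nat _ (n := k.+1))//=.
rewrite [X in _ + (_ + X)]big_nat_cond [X in _ + (_ + X)]big1 ?addr0; last first.
  move=> j /andP[/andP[kj jn] _]; rewrite /F max_r// subr_le0.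
  by apply: sorted_abs_nonincr => //; exact: ltnW.
have -> : \sum_(0 <= j < k.+1) F (sorted_abs u j) = T k.+1 u - c *+ k.+1.
  rewrite /T -[X in c *+ X]subn0 -sumr_const_nat -sumrB; apply: eq_big_nat => j /andP[_ jk].
  by rewrite /F max_l// subr_ge0 sorted_abs_nonincr.
by rewrite addrCA gerDl subr_le0 ler_wpMn2l.
Qed.

Lemma Jsort_nat (lamf : nat -> R) u :
  Jsort (fun j : 'I_n => lamf j) u = \sum_(0 <= j < n) lamf j * sorted_abs u j.
Proof. by rewrite big_mkord. Qed.

(** Rearrangement inequality: after relabelling, [u] is sorted and supplies the weights of the Abel
    summation, while partial sums of the relabelled [e] are bounded by [sum_le_top]. *)
Lemma sum_mul_le_sorted e u : \sum_i e i * u i <=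
  \sum_(0 <= j < n) sorted_abs e j * sorted_abs u j.
Proof.
have [pi hpi] := sorted_abs_perm u.
(* Extended by 0 beyond [n], since Abel summation is stated for sequences indexed by [nat]. *)
pose a j : R := oapp (fun i => `|e (pi i)|) 0 (insub j : option 'I_n).
have aE (i : 'I_n) : a i = `|e (pi i)| by rewrite /a valK.
apply: (@le_trans _ _ (\sum_(0 <= j < n) sorted_abs u j * a j)).
  rewrite big_mkord (reindex_inj (@perm_inj _ pi))/=.
  apply: ler_sum => j _; rewrite hpi aE mulrC.
  by rewrite -normrM ler_norm.
under [leRHS]eq_bigr do rewrite mulrC.
apply: sum_nonincr_weights_le => [j jn|j _|k kn].
- exact: sorted_abs_nonincr.
- exact: sorted_abs_ge0.
pose K := [set j : 'I_n | (j < k)%N]%SET.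
have <- : \sum_(i in (pi @: K)%SET) `|e i| = \sum_(0 <= j < k) a j.
  rewrite big_imset/=; last by move=> x y _ _; exact: perm_inj.
  rewrite big_mkord (big_ord_widen n a)//.
  by apply: eq_big => [j|j _]; rewrite ?inE// aE.
apply: sum_le_top => //; rewrite card_imset; last exact: perm_inj.
by rewrite /K cardsE -sum1_card -(big_ord_widen n (fun=> 1%N))// sum_nat_const card_ord muln1.
Qed.

(** * Convexity of the sorted norm and its decrease at sparse vectors *)

Section Weights.
Variable lamf : nat -> R.
Hypothesis lamS : forall j, (j.+1 < n)%N -> lamf j.+1 <= lamf j.
Hypothesis lam0 : forall j, (j < n)%N -> 0 <= lamf j.

Let J u := Jsort (fun j : 'I_n => lamf j) u.

(** By Abel summation it is enough that each [T k] is convex, and [T k] is the maximum of the sums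
    of absolute values over sets of size [k]. *)
Lemma Jsort_convex (t : R) u v : 0 <= t <= 1 ->
  J (fun i => (1 - t) * u i + t * v i) <= (1 - t) * J u + t * J v.
Proof.
move=> /andP[t0 t1]; rewrite /J !Jsort_nat !mulr_sumr -big_split/=.
under [leRHS]eq_bigr do rewrite !(mulrCA _ (lamf _)) -mulrDr.
apply: sum_nonincr_weights_le => // k kn.
rewrite big_split/= -!mulr_sumr.
have [I cI /(_ idfun) /= <-] := top_set (fun i => (1 - t) * u i + t * v i) kn.
have hu := sum_le_top u kn (eq_leq cI); have hv := sum_le_top v kn (eq_leq cI).
apply: (@le_trans _ _ ((1 - t) * \sum_(i in I) `|u i| + t * \sum_(i in I) `|v i|)).
  rewrite !mulr_sumr -big_split/=; apply: ler_sum => i _.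
  apply: le_trans (ler_normD _ _) _; rewrite !normrM (ger0_norm t0) ger0_norm//.
  by rewrite subr_ge0.
by apply: lerD; apply: ler_wpM2l => //; rewrite subr_ge0.
Qed.

(* By Abel summation it suffices to compare the sums [T k] of the [k] largest
   entries. For [k > s], the set [S :|: I] with [I] a subset of size [k - s] of
   the top [k] entries of [h] outside [S] competes in [T k (a + h)]. *)
Lemma Jsort_diff (s : nat) (a h : 'I_n -> R) (S : {set 'I_n}) : (#|S| <= s)%N -> (s <= n)%N ->
  (forall i, i \notin S -> a i = 0) ->
  J a - J (fun i => a i + h i) <=
  \sum_(0 <= j < s) lamf j * sorted_abs h j - \sum_(s <= j < n) lamf j * sorted_abs h j.
Proof.
move=> Ss sn aS.
pose sg j : R := if (j < s)%N then 1 else -1.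
have -> : \sum_(0 <= j < s) lamf j * sorted_abs h j -
    \sum_(s <= j < n) lamf j * sorted_abs h j =
    \sum_(0 <= j < n) lamf j * (sg j * sorted_abs h j).
  rewrite [RHS](big_cat_nat _ (n := s))//= -sumrN; congr (_ + _).
    by apply: eq_big_nat => j /andP[_ js]; rewrite /sg js mul1r.
  by apply: eq_big_nat => j /andP[sj _]; rewrite /sg ltnNge sj mulN1r mulrN.
rewrite /J !Jsort_nat -sumrB.
under [leLHS]eq_bigr do rewrite -mulrBr.
apply: sum_nonincr_weights_le => // k kn.
rewrite sumrB -/(T _ _) -/(T k (fun i => a i + h i)).
have [ks|sk] := leqP k s.
  have -> : \sum_(0 <= j < k) sg j * sorted_abs h j = T k h.
    by apply: eq_big_nat => j /andP[_ jk]; rewrite /sg (leq_trans jk ks) mul1r.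
  have [I cI /(_ idfun) /= hI] := top_set a kn.
  rewrite lerBlDl /T -hI.
  apply: le_trans (lerD (sum_le_top (fun i => a i + h i) kn (eq_leq cI))
    (sum_le_top h kn (eq_leq cI))).
  rewrite -big_split/=; apply: ler_sum => i _.
  by rewrite -[X in `|X| <= _](addrK (h i)); exact: ler_normB.
have -> : \sum_(0 <= j < k) sg j * sorted_abs h j = 2 * T s h - T k h.
  have -> : T k h = T s h + \sum_(s <= j < k) sorted_abs h j.
    by rewrite /T (big_cat_nat _ (n := s))//= ltnW.
  rewrite (big_cat_nat _ (n := s))//= 1?ltnW//.
  have -> : \sum_(0 <= j < s) sg j * sorted_abs h j = T s h.
    by apply: eq_big_nat => j /andP[_ js]; rewrite /sg js mul1r.
  have -> : \sum_(s <= j < k) sg j * sorted_abs h j = - \sum_(s <= j < k) sorted_abs h j.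
    rewrite -sumrN; apply: eq_big_nat => j /andP[sj _].
    by rewrite /sg ltnNge sj mulN1r.
  by ring.
have [K cK /(_ idfun) /= hK] := top_set h kn.
(* At most [s] of the [k] elements of [K] lie in [S]. The part of [K] left out by [I] has exactly
   [s] elements, so it costs at most [T s h]; the triangle inequality on [S] costs a second
   [T s h]. *)
have [I IKS cI] : exists2 I : {set 'I_n}, I \subset (K :\: S)%SET & #|I| = (k - s)%N.
  apply: subset_of_card; rewrite cardsD cK leq_sub2l//.
  by apply: leq_trans Ss; apply: subset_leq_card; exact: subsetIr.
have IK : I \subset K by apply: fintype.subset_trans IKS _; exact: subsetDl.
have dSI : [disjoint S & I]%B.
  apply/pred0P => i /=; apply/negP => /andP[iS iI].
  by have /fintype.subsetP/(_ _ iI) := IKS; rewrite inE iS.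
have cD : #|(K :\: I)%SET| = s.
  by rewrite cardsD (finset.setIidPr IK) cK cI subKn// ltnW.
have hD : \sum_(i in (K :\: I)%SET) `|h i| <= T s h.
  by apply: sum_le_top => //; rewrite cD.
have hS : \sum_(i in S) `|h i| <= T s h by exact: sum_le_top.
have hI : \sum_(i in I) `|h i| = T k h - \sum_(i in (K :\: I)%SET) `|h i|.
  by rewrite /T -hK [X in _ = X - _](big_setID I)/= (finset.setIidPr IK) addrK.
have h1 : T k a <= \sum_(i in S) `|a i|.
  have [I' _ /(_ idfun) /= hI'] := top_set a kn.
  rewrite /T -hI' (big_setID S)/= [X in _ + X]big1 ?addr0; last first.
    by move=> i; rewrite inE => /andP[iS _]; rewrite aS ?normr0.
  rewrite [leRHS](big_setID I')/= finset.setIC ler_wpDr//.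
  by apply: sumr_ge0.
have h2 : \sum_(i in S) `|a i + h i| + \sum_(i in I) `|h i| <= T k (fun i => a i + h i).
  have <- : \sum_(i in I) `|a i + h i| = \sum_(i in I) `|h i|.
    apply: eq_bigr => i iI; rewrite aS ?add0r//.
    by have /fintype.subsetP/(_ _ iI) := IKS; rewrite inE => /andP[].
  have <- : \sum_(i in (S :|: I)%SET) `|a i + h i| =
      \sum_(i in S) `|a i + h i| + \sum_(i in I) `|a i + h i|.
    by rewrite -bigU//=; apply: eq_bigl => i; rewrite !inE.
  apply: sum_le_top => //; rewrite (leq_trans (leq_card_setU _ _))//.
  rewrite cI; apply: leq_trans (leq_add Ss (leqnn _)) _.
  by rewrite subnKC// ltnW.
have h3 : \sum_(i in S) `|a i| - \sum_(i in S) `|h i| <= \sum_(i in S) `|a i + h i|.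
  rewrite -sumrB; apply: ler_sum => i _; rewrite lerBlDr.
  by rewrite -[X in `|X| <= _](addrK (h i)); exact: ler_normB.
clear cK cI cD; lra.
Qed.

End Weights.
End SortedAbs.

(** * The deterministic part *)

Section VectorNorms.
Context {R : realType} {m : nat}.
Implicit Types u v : 'I_m -> R.

Lemma sqnorm_ge0 u : 0 <= sqnorm u.
Proof. by apply: sumr_ge0 => i _; exact: sqr_ge0. Qed.

Lemma sqr_l2 u : l2 u ^+ 2 = sqnorm u.
Proof. by rewrite sqr_sqrtr// sqnorm_ge0. Qed.

Lemma l0_support u (k : nat) : (l0 u <= k)%N ->
  exists2 S : {set 'I_m}, (#|S| <= k)%N & forall i, i \notin S -> u i = 0.
Proof.
move=> uk; exists [set i | u i != 0]%SET; last by move=> i; rewrite inE negbK => /eqP.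
apply: leq_trans uk; apply: subset_leq_card; apply/fintype.subsetP => i.
by rewrite inE => ui; rewrite mem_set.
Qed.

Lemma sum_abs_le_l2 u (S : {set 'I_m}) (k : nat) : (#|S| <= k)%N ->
  \sum_(i in S) `|u i| <= Num.sqrt k%:R * l2 u.
Proof.
move=> Sk; rewrite (eq_bigr (fun i => 1 * `|u i|)); last by move=> i _; rewrite mul1r.
apply: le_trans (cauchy_schwarz_sqrt _ _ _ _) _.
apply: ler_pM; rewrite ?sqrtr_ge0//; apply: ler_wsqrtr.
  by under eq_bigr do rewrite expr1n; rewrite sumr_const ler_nat.
rewrite /sqnorm [leRHS](bigID (mem S))/= ler_wpDr//.
  by apply: sumr_ge0 => i _; exact: sqr_ge0.
by apply: ler_sum => i _; rewrite real_normK ?num_real.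
Qed.

Lemma l1_convex (t : R) u v : 0 <= t <= 1 ->
  l1 (fun i => (1 - t) * u i + t * v i) <= (1 - t) * l1 u + t * l1 v.
Proof.
move=> /andP[t0 t1]; rewrite /l1 !mulr_sumr -big_split/=; apply: ler_sum => i _.
apply: le_trans (ler_normD _ _) _; rewrite !normrM (ger0_norm t0) ger0_norm//.
by rewrite subr_ge0.
Qed.

(** The reverse triangle inequality is used on [S]; off [S], where [u] vanishes, each term equals
    [- |v i - u i|]. Completing the latter sum to the full norm produces the 2. *)
Lemma l1_diff u v (S : {set 'I_m}) : (forall i, i \notin S -> u i = 0) ->
  l1 u - l1 v <= 2 * \sum_(i in S) `|v i - u i| - l1 (fun i => v i - u i).
Proof.
move=> uS; rewrite /l1 -sumrB [X in _ <= _ - X](bigID (mem S))/=.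
rewrite [leLHS](bigID (mem S))/=.
have h1 : \sum_(i in S) (`|u i| - `|v i|) <= \sum_(i in S) `|v i - u i|.
  by apply: ler_sum => i _; rewrite distrC lerB_dist.
have h2 : \sum_(i | i \notin S) (`|u i| - `|v i|) = - \sum_(i | i \notin S) `|v i - u i|.
  by rewrite -sumrN; apply: eq_bigr => i iS; rewrite uS// normr0 sub0r subr0.
by rewrite h2; lra.
Qed.

End VectorNorms.

(** After rearrangement, for [j >= s] the top [j.+1] squares of [e] are each at least the last of
    them, so [sorted_abs e j <= C * lamf j]. The first [s] positions use Cauchy-Schwarz, with
    [s * lamf s.-1 ^+ 2] bounded by the sum of the first [s] squared weights. *)
Lemma sorted_noise_le {R : realType} {n s : nat} (lamf : nat -> R) (C : R) (e u : 'I_n -> R) :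
  (0 < s)%N -> (s <= n)%N -> 0 <= C ->
  (forall i j, (i <= j)%N -> (j < n)%N -> lamf j <= lamf i) ->
  (forall j, (j < n)%N -> 0 <= lamf j) ->
  (forall I : {set 'I_n}, (s <= #|I|)%N ->
     \sum_(i in I) e i ^+ 2 <= C ^+ 2 * (#|I|%:R * lamf #|I|.-1 ^+ 2)) ->
  \sum_i e i * u i <= C * (Num.sqrt (\sum_(0 <= j < s) lamf j ^+ 2) * l2 u +
     \sum_(s <= j < n) lamf j * sorted_abs u j).
Proof.
move=> s0 sn C0 lamS lam0 he.
have hk k : (s <= k)%N -> (k <= n)%N ->
    \sum_(0 <= j < k) sorted_abs e j ^+ 2 <= C ^+ 2 * (k%:R * lamf k.-1 ^+ 2).
  move=> sk kn; have [I cI /(_ (fun x => x ^+ 2)) <-] := top_set e kn.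
  rewrite -cI; apply: le_trans (he I _); last by rewrite cI.
  by apply: ler_sum => i _; rewrite real_normK ?num_real.
apply: le_trans (sum_mul_le_sorted e u) _.
rewrite (big_cat_nat _ (n := s))//= mulrDr; apply: lerD; last first.
  rewrite mulr_sumr; apply: ler_sum_nat => j /andP[sj jn].
  rewrite mulrA; apply: ler_wpM2r; first exact: sorted_abs_ge0.
  have lj : 0 <= C * lamf j by rewrite mulr_ge0 ?lam0.
  rewrite -ler_sqr ?nnegrE ?sorted_abs_ge0//.
  have j0 : 0 < j.+1%:R :> R by rewrite ltr0n.
  rewrite -(ler_pM2l j0) exprMn [leRHS]mulrCA.
  apply: le_trans (hk j.+1 (leqW sj) jn).
  rewrite mulr_natl -[X in _ *+ X]subn0 -sumr_const_nat; apply: ler_sum_nat => i /andP[_ ij].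
  by rewrite ler_sqr ?nnegrE ?sorted_abs_ge0// sorted_abs_nonincr.
apply: le_trans (cauchy_schwarz_sqrt _ _ _ _) _.
rewrite mulrA; apply: ler_pM; rewrite ?sqrtr_ge0//.
  rewrite -[X in X * _](ger0_norm C0) -sqrtr_sqr -sqrtrM ?sqr_ge0//; apply: ler_wsqrtr.
  apply: le_trans (hk s (leqnn _) sn) _; apply: ler_wpM2l; first exact: sqr_ge0.
  rewrite mulr_natl -[X in _ *+ X]subn0 -sumr_const_nat; apply: ler_sum_nat => i /andP[_ ils].
  have si : (s.-1 < n)%N by rewrite prednK.
  rewrite ler_sqr ?nnegrE ?lam0 ?(leq_trans ils)// lamS//.
  by rewrite -ltnS prednK.
apply: ler_wsqrtr; rewrite /sqnorm (eq_bigr (fun i => `|u i| ^+ 2) (F1 := fun i => u i ^+ 2)); last first.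
  by move=> i _; rewrite real_normK ?num_real.
rewrite -(sum_sorted_abs (fun x => x ^+ 2)) [leRHS](big_cat_nat _ (n := s))//= ler_wpDr//.
by apply: sumr_ge0 => i _; exact: sqr_ge0.
Qed.

Lemma le0_of_le_small (R : realFieldType) (a b : R) :
  (forall t, 0 < t <= 1 -> a <= t * b) -> a <= 0.
Proof.
move=> h; rewrite leNgt; apply/negP => a0.
have b0 : 0 < b by have := h 1; rewrite ltr01 lexx mul1r => /(_ isT); lra.
have ab : a <= b by have := h 1; rewrite ltr01 lexx mul1r => /(_ isT).
(* This value is at most 1 because [a <= b], and it would give [a <= a / 2]. *)
have := h (a / (2 * b)).
rewrite divr_gt0 ?mulr_gt0//= ler_pdivrMr ?mulr_gt0// mul1r => /(_ _).
have -> : a / (2 * b) * b = a / 2 by field; rewrite gt_eqF.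
by move=> /(_ _); lra.
Qed.

(* Comparing the minimiser with the points of the segment joining it to
   [(bstar, mstar)] yields the variational inequality, which improves the naive
   comparison with [(bstar, mstar)] by a factor two. *)
Lemma basic_inequality {R : realType} {n p : nat} (X : 'M[R]_(n, p)) (bs bh : 'I_p -> R)
    (ms mh e : 'I_n -> R) (lamf : nat -> R) (nu rho : R) :
  0 <= nu -> 0 <= rho ->
  (forall j, (j.+1 < n)%N -> lamf j.+1 <= lamf j) ->
  (forall j, (j < n)%N -> 0 <= lamf j) ->
  let lam := fun j : 'I_n => lamf j in
  let obj := fun b m => sqnorm (fun i => mulXv X bs i + ms i + e i - mulXv X b i - m i)
    + 2 * nu * l1 b + 2 * rho * Jsort lam m in
  let hb := fun j => bh j - bs j in
  let hm := fun i => mh i - ms i in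
  (forall b m, obj bh mh <= obj b m) ->
  sqnorm (fun i => mulXv X hb i + hm i) <=
  \sum_i e i * (mulXv X hb i + hm i) + nu * (l1 bs - l1 bh) +
  rho * (Jsort lam ms - Jsort lam mh).
Proof.
move=> nu0 rho0 lamS lam0 lam obj hb hm hopt.
pose d i := mulXv X hb i + hm i.
have dE i : mulXv X hb i = mulXv X bh i - mulXv X bs i.
  by rewrite /mulXv -sumrB; apply: eq_bigr => j _; rewrite /hb mulrBr.
have rE i : mulXv X bs i + ms i + e i - mulXv X bh i - mh i = e i - d i.
  by rewrite /d dE /hm; ring.
suff : 2 * (sqnorm d - (\sum_i e i * d i + nu * (l1 bs - l1 bh) +
    rho * (Jsort lam ms - Jsort lam mh))) <= 0 by rewrite /d; lra.
(* Moving a fraction [t] towards the truth and dividing by [t] leaves only the error [t * sqnorm d],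
   which vanishes with [t]. *)
apply: (@le0_of_le_small _ _ (sqnorm d)) => t /andP[t0 t1].
have t01 : 0 <= t <= 1 by rewrite ltW.
pose bt j := (1 - t) * bh j + t * bs j; pose mt i := (1 - t) * mh i + t * ms i.
have := hopt bt mt.
have Xbt i : mulXv X bt i = (1 - t) * mulXv X bh i + t * mulXv X bs i.
  rewrite /mulXv !mulr_sumr -big_split/=; apply: eq_bigr => j _; rewrite /bt; ring.
have -> : obj bt mt = sqnorm (fun i => e i - d i + t * d i) + 2 * nu * l1 bt +
    2 * rho * Jsort lam mt.
  rewrite /obj; congr (_ + _ + _); apply: eq_bigr => i _; congr (_ ^+ 2).
  by rewrite Xbt /mt /d dE /hm; ring.
have -> : obj bh mh = sqnorm (fun i => e i - d i) + 2 * nu * l1 bh + 2 * rho * Jsort lam mh.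
  by rewrite /obj; congr (_ + _ + _); apply: eq_bigr => i _; rewrite rE.
have -> : sqnorm (fun i => e i - d i + t * d i) =
    sqnorm (fun i => e i - d i) + 2 * t * (\sum_i e i * d i) - 2 * t * sqnorm d
    + t ^+ 2 * sqnorm d.
  rewrite /sqnorm !mulr_sumr -big_split/= -sumrB -big_split/=.
  by apply: eq_bigr => i _; ring.
have hl := @l1_convex _ _ t bh bs t01.
have hJ := @Jsort_convex R n lamf lamS lam0 t mh ms t01.
have hl' : nu * l1 bt <= nu * ((1 - t) * l1 bh + t * l1 bs) by apply: ler_wpM2l.
have hJ' : rho * Jsort lam mt <= rho * ((1 - t) * Jsort lam mh + t * Jsort lam ms).
  by apply: ler_wpM2l.
move=> h; rewrite -(ler_pM2l t0); move: hl' hJ' h; clear -t0.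
set D := sqnorm d; set ed := \sum_i _; set Dm := sqnorm _.
by move=> hl' hJ' h; nra.
Qed.

(** * The weights [lambda_j] and their sums of squares *)

Section SlopeWeights.
Context {R : realType}.
Variables (n : nat) (sigma : R).
Hypothesis sigma0 : 0 < sigma.

Let lamf (j : nat) : R := sigma * Num.sqrt (ln ((2 * n)%:R / j.+1%:R)).

Lemma ln_ratio_ge j : (j < n)%N -> ln 2 <= ln ((2 * n)%:R / j.+1%:R) :> R.
Proof.
move=> jn; have n0 : (0 < n)%N by exact: leq_trans jn.
rewrite ler_ln ?posrE ?divr_gt0 ?ltr0n ?muln_gt0//.
by rewrite ler_pdivlMr ?ltr0n// -natrM ler_nat leq_mul2l.
Qed.

Lemma slope_weight_nonincr i j : (i <= j)%N -> (j < n)%N -> lamf j <= lamf i.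
Proof.
move=> ij jn; have n0 : (0 < n)%N by exact: leq_trans jn.
apply: ler_wpM2l; first exact: ltW; apply: ler_wsqrtr.
rewrite ler_ln ?posrE ?divr_gt0 ?ltr0n ?muln_gt0//.
by rewrite ler_pM2l ?ltr0n ?muln_gt0// lef_pV2 ?posrE ?ltr0n// ler_nat.
Qed.

Lemma slope_weight_ge0 j : 0 <= lamf j.
Proof. by rewrite mulr_ge0 ?sqrtr_ge0// ltW. Qed.

Lemma sqr_slope_weight j : (j < n)%N ->
  lamf j ^+ 2 = sigma ^+ 2 * ln ((2 * n)%:R / j.+1%:R).
Proof.
move=> jn; rewrite exprMn sqr_sqrtr//.
by apply: le_trans (ln_ratio_ge jn); have := @ln2_ge R; lra.
Qed.

Lemma slope_weight_last : (0 < n)%N -> lamf n.-1 = sigma * Num.sqrt (ln 2).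
Proof.
move=> n0; rewrite /lamf prednK// natrM mulfK// pnatr_eq0.
by rewrite -lt0n.
Qed.

(** Equivalent to s! >= (s/e)^s. The induction step is ln(s+1) - ln s <= 1/s, multiplied by s. *)
Lemma sum_ln_ratio_le s : (0 < n)%N -> (0 < s)%N ->
  \sum_(0 <= j < s) ln ((2 * n)%:R / j.+1%:R) <= s%:R * (1 + ln ((2 * n)%:R / s%:R)) :> R.
Proof.
move=> n0; have nR : 0 < (2 * n)%:R :> R by rewrite ltr0n muln_gt0.
case: s => // s _; elim: s => [|s IH]; first by rewrite big_nat1 mul1r; lra.
rewrite big_nat_recr//=; apply: le_trans (lerD IH (lexx _)) _.
have sR : 0 < s.+1%:R :> R by rewrite ltr0n.
have sR2 : 0 < s.+2%:R :> R by rewrite ltr0n.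
rewrite !ln_div ?posrE//.
have h : ln s.+2%:R - ln s.+1%:R <= s.+1%:R^-1 :> R.
  rewrite -ln_div ?posrE//.
  have -> : s.+2%:R / s.+1%:R = 1 + s.+1%:R^-1 :> R.
    by rewrite -[s.+2%:R]natr1; field; rewrite gt_eqF.
  by apply: le_ln1Dx; rewrite (lt_trans _ (_ : 0 < _))// ?invr_gt0// ltrN10.
have := ler_wpM2l (ltW sR) h; rewrite divff ?gt_eqF//.
rewrite -[s.+2%:R]natr1; nra.
Qed.

Lemma sum_sqr_slope_weight_le s : (0 < s)%N -> (s <= n)%N ->
  \sum_(0 <= j < s) lamf j ^+ 2 <=
  sigma ^+ 2 * (s%:R * ln (2 * expR 1 * n%:R / s%:R)).
Proof.
move=> s0 sn; have n0 : (0 < n)%N by exact: leq_trans sn.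
have nR : 0 < (2 * n)%:R :> R by rewrite ltr0n muln_gt0.
have -> : 2 * expR 1 * n%:R / s%:R = expR 1 * ((2 * n)%:R / s%:R) :> R.
  by rewrite natrM; ring.
have q0 : 0 < (2 * n)%:R / s%:R :> R by rewrite divr_gt0// ltr0n.
rewrite lnM ?posrE ?expR_gt0// expRK.
rewrite (eq_big_nat _ _ (F2 := fun j => sigma ^+ 2 * ln ((2 * n)%:R / j.+1%:R))); last first.
  by move=> j /andP[_ js]; rewrite sqr_slope_weight// (leq_trans js).
by rewrite -mulr_sumr ler_wpM2l ?sqr_ge0// sum_ln_ratio_le.
Qed.

End SlopeWeights.

(** From [2 * K * A * x <= K ^+ 2 * x ^+ 2 + A ^+ 2], and likewise for [y], half of the left-hand
    side is absorbed. *)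
Lemma quadratic_le (R : realFieldType) (K A B x y : R) : 0 < K ->
  K * (x ^+ 2 + y ^+ 2) <= A * x + B * y ->
  x ^+ 2 + y ^+ 2 <= (A ^+ 2 + B ^+ 2) / K ^+ 2.
Proof.
move=> K0 h; rewrite ler_pdivlMr ?exprn_gt0//.
have := ler_wpM2l (ltW K0) h.
have := sqr_ge0 (K * x - A); have := sqr_ge0 (K * y - B); nra.
Qed.

(** * The rate of the estimator for a fixed well-behaved noise vector *)

Section Deterministic.
Context {R : realType} {n p k s : nat}.
Variables (X : 'M[R]_(n, p)) (bs : 'I_p -> R) (ms e : 'I_n -> R).
Variables (sigma rho kappa1 kappa2 : R).

Lemma slope_rate (bh : 'I_p -> R) (mh : 'I_n -> R) :
  (0 < s)%N -> (s <= n)%N -> (l0 bs <= k)%N -> (l0 ms <= s)%N -> 0 < sigma ->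
  let lamf := fun j : nat => sigma * Num.sqrt (ln ((2 * n)%:R / j.+1%:R)) in
  let lam := fun j : 'I_n => lamf (nat_of_ord j) in
  let nu := 4 * sigma * Num.sqrt (ln p%:R) in
  2 * (4 + Num.sqrt 2) <= rho ->
  rho * ln 2 / 4 <= Num.sqrt (ln p%:R) ->
  let k1 := 16 * k%:R * ln p%:R / ln 2 in
  let s1 := s%:R * ln (2 * expR 1 * n%:R / s%:R) / ln 2 in
  2 * kappa2 < kappa1 ->
  (forall (b : 'I_p -> R) (m : 'I_n -> R),
     l1 b + \sum_(j < n) (lam j / lamf n.-1) * sorted_abs m j
       <= 5 * (Num.sqrt k1 * l2 b + Num.sqrt s1 * l2 m) ->
     kappa1 * (sqnorm b + sqnorm m) <= sqnorm (mulXv X b) + sqnorm m /\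
     `|dotp (mulXv X b) m| <= kappa2 * (sqnorm b + sqnorm m)) ->
  (forall j, `|\sum_i X i j * e i| <= 2 * Num.sqrt (ln p%:R) * sigma) ->
  (forall I : {set 'I_n}, (s <= #|I|)%N ->
     \sum_(i in I) (e i / sigma) ^+ 2 <= 80 / 3 * slope_entropy n #|I|) ->
  (forall b m,
    sqnorm (fun i => mulXv X bs i + ms i + e i - mulXv X bh i - mh i)
      + 2 * nu * l1 bh + 2 * rho * Jsort lam mh <=
    sqnorm (fun i => mulXv X bs i + ms i + e i - mulXv X b i - m i)
      + 2 * nu * l1 b + 2 * rho * Jsort lam m) ->
  sqnorm (fun j => bh j - bs j) + sqnorm (fun i => mh i - ms i) <=
  (36 * sigma ^+ 2 * k%:R * ln p%:R + 4 * rho ^+ 2 * \sum_(0 <= j < s) lamf j ^+ 2) /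
  (kappa1 - 2 * kappa2) ^+ 2.
Proof.
move=> s0 sn bk msup sigma0 lamf lam nu hrho hp k1 s1 hkappa RE hX hI hopt.
have n0 : (0 < n)%N by exact: leq_trans sn.
have ln2 := @ln2_ge R.
(* This gives [rho >= 52/5], hence [(rho / 2) ^+ 2 >= 676/25 >= 80/3], the constant of the
   chi-square event. *)
have sq2 : 6 / 5 <= Num.sqrt 2 :> R.
  by rewrite -[leLHS]ger0_norm ?divr_ge0// -sqrtr_sqr ler_wsqrtr//; lra.
have rho_ge : 52 / 5 <= rho by lra.
have rho0 : 0 <= rho by lra.
pose q : R := Num.sqrt (ln p%:R).
have nuE : nu = 4 * sigma * q by [].
rewrite -/q in hp.
have q0 : 0 < q by apply: lt_le_trans hp; rewrite divr_gt0// mulr_gt0//; lra.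
have nu0 : 0 < nu by rewrite nuE !mulr_gt0.
have lnp : q ^+ 2 = ln p%:R.
  by rewrite sqr_sqrtr// ltW//; move: q0; rewrite sqrtr_gt0.
pose hb j := bh j - bs j; pose hm i := mh i - ms i.
have lamN i j := @slope_weight_nonincr R n sigma sigma0 i j.
have lam0 j := @slope_weight_ge0 R n sigma sigma0 j.
have lamS j : (j.+1 < n)%N -> lamf j.+1 <= lamf j by exact: lamN.
have basic := @basic_inequality R n p X bs bh ms mh e lamf nu rho (ltW nu0) rho0
  lamS (fun j _ => lam0 j) hopt.
rewrite /= -/hb -/hm -/lam in basic.
have [S cS bsS] := l0_support bk.
have [M cM msM] := l0_support msup.
pose Lam := Num.sqrt (\sum_(0 <= j < s) lamf j ^+ 2).
pose Jt := \sum_(0 <= j < s) lamf j * sorted_abs hm j.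
pose Jr := \sum_(s <= j < n) lamf j * sorted_abs hm j.
pose b1 := \sum_(i in S) `|hb i|.
have noise_b : \sum_i e i * mulXv X hb i <= nu / 2 * l1 hb.
  have -> : \sum_i e i * mulXv X hb i = \sum_j (\sum_i X i j * e i) * hb j.
    under eq_bigr do rewrite /mulXv mulr_sumr.
    rewrite exchange_big/=; apply: eq_bigr => j _; rewrite mulr_suml.
    by apply: eq_bigr => i _; ring.
  rewrite /l1 mulr_sumr; apply: ler_sum => j _.
  apply: le_trans (ler_norm _) _; rewrite normrM ler_wpM2r//.
  by apply: le_trans (hX j) _; rewrite /nu -/q; lra.
have noise_m : \sum_i e i * hm i <= rho / 2 * (Lam * l2 hm + Jr).
  apply: sorted_noise_le => // [|j _|I sI]; [by lra|exact: lam0|].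
  have In : (#|I| <= n)%N by have := max_card (mem I); rewrite card_ord.
  have I0 : (0 < #|I|)%N by exact: leq_trans sI.
  have Ip : (#|I|.-1 < n)%N by rewrite prednK.
  rewrite [lamf _ ^+ 2](sqr_slope_weight sigma Ip) prednK//.
  have -> : (rho / 2) ^+ 2 * (#|I|%:R * (sigma ^+ 2 * ln ((2 * n)%:R / #|I|%:R))) =
      sigma ^+ 2 * ((rho / 2) ^+ 2 * slope_entropy n #|I|) by rewrite /slope_entropy; ring.
  have -> : \sum_(i in I) e i ^+ 2 = sigma ^+ 2 * \sum_(i in I) (e i / sigma) ^+ 2.
    rewrite mulr_sumr; apply: eq_bigr => i _; field.
    by rewrite gt_eqF.
  rewrite ler_wpM2l ?sqr_ge0//; apply: le_trans (hI I sI) _.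
  have L0 : 0 <= slope_entropy n #|I| :> R.
    apply: le_trans (slope_entropy_ge I0 In); rewrite mulr_ge0//; lra.
  rewrite ler_wpM2r//; nra.
have hl1 : l1 bs - l1 bh <= 2 * b1 - l1 hb by exact: l1_diff.
have hJ : Jsort lam ms - Jsort lam mh <= Jt - Jr.
  have -> : Jsort lam mh = Jsort lam (fun i => ms i + hm i).
    by congr Jsort; apply/funext => i; rewrite /hm; ring.
  exact: (@Jsort_diff R n lamf lamS (fun j _ => lam0 j) s ms hm M cM sn msM).
have hb1 : b1 <= Num.sqrt k%:R * l2 hb by exact: sum_abs_le_l2.
have hJt : Jt <= Lam * l2 hm.
  apply: le_trans (cauchy_schwarz_sqrt _ _ _ _) _.
  apply: ler_wpM2l; first exact: sqrtr_ge0; apply: ler_wsqrtr.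
  rewrite /sqnorm (eq_bigr (fun i => `|hm i| ^+ 2) (F1 := fun i => hm i ^+ 2)); last first.
    by move=> i _; rewrite real_normK ?num_real.
  rewrite -(sum_sorted_abs (fun x => x ^+ 2)) [leRHS](big_cat_nat _ (n := s))//= ler_wpDr//.
  by apply: sumr_ge0 => i _; exact: sqr_ge0.
have b1le : b1 <= l1 hb.
  by rewrite /l1 [leRHS](bigID (mem S))/= ler_wpDr//; apply: sumr_ge0.
have Jr0 : 0 <= Jr by apply: sumr_ge0 => j _; rewrite mulr_ge0 ?sorted_abs_ge0 ?lam0.
set D := sqnorm _ in basic.
have D0 : 0 <= D by exact: sqnorm_ge0.
have edE : \sum_i e i * (mulXv X hb i + hm i) =
    \sum_i e i * mulXv X hb i + \sum_i e i * hm i.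
  by rewrite -big_split/=; apply: eq_bigr => i _; rewrite mulrDr.
have x0 : 0 <= l2 hb by exact: sqrtr_ge0.
have y0 : 0 <= l2 hm by exact: sqrtr_ge0.
have Lam0 : 0 <= Lam by exact: sqrtr_ge0.
have nul1 := ler_wpM2l (ltW nu0) hl1; have rhoJ := ler_wpM2l rho0 hJ.
have nub1 := ler_wpM2l (ltW nu0) hb1; have rhoJt := ler_wpM2l rho0 hJt.
have nuble := ler_wpM2l (ltW nu0) b1le; have rhoJr := mulr_ge0 rho0 Jr0.
have rhoL : 0 <= rho * (Lam * l2 hm) by rewrite !mulr_ge0.
(* The noise takes back half of the gains [nu * l1 hb] and [rho * Jr], and adds half a
   [rho * Lam * l2 hm] to the one coming from [Jt]. *)
have D_le : D <= nu * (2 * b1 - l1 hb / 2) + rho * (3 / 2 * (Lam * l2 hm) - Jr / 2).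
  by move: basic; rewrite edE; lra.
(* Twice [D_le] with [D >= 0]; adding [rho * Jt] to both sides raises the last coefficient from 3 to
   4. *)
have cone : nu * l1 hb + rho * (Jt + Jr) <=
    4 * (nu * (Num.sqrt k%:R * l2 hb)) + 4 * (rho * (Lam * l2 hm)) by lra.
have sL := slope_weight_last sigma n0.
set c := Num.sqrt (ln 2 : R) in sL.
have c2 : c ^+ 2 = ln 2 by rewrite sqr_sqrtr//; lra.
have c_ge : 4 / 5 <= c.
  by rewrite -[leLHS]ger0_norm ?divr_ge0// -sqrtr_sqr ler_wsqrtr//; lra.
have c0 : 0 < c by lra.
have c1 : c <= 1.
  rewrite -[leRHS]sqrtr1; apply: ler_wsqrtr.
  by have := @le_ln1Dx R 1; rewrite -[1 + 1]/2; apply; lra.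
(* The last weight is [sigma * c] with [c = sqrt (ln 2)]. After multiplication by
   [rho * sigma * c ^+ 2], at most [nu] by [hp], the claim follows from [cone]: [c <= 1] handles the
   left-hand side, and [5 * c >= 4] explains the 5 in place of 4. *)
have in_cone : l1 hb + \sum_(j < n) (lam j / lamf n.-1) * sorted_abs hm j <=
    5 * (Num.sqrt k1 * l2 hb + Num.sqrt s1 * l2 hm).
  have -> : \sum_(j < n) (lam j / lamf n.-1) * sorted_abs hm j = (Jt + Jr) / (sigma * c).
    rewrite -sL /Jt /Jr -(big_cat_nat _ (n := s))//= big_mkord mulr_suml.
    by apply: eq_bigr => j _; rewrite mulrAC.
  have -> : Num.sqrt k1 = 4 * Num.sqrt k%:R * q / c.
    rewrite -[RHS]ger0_norm; last by rewrite !mulr_ge0 ?invr_ge0 ?sqrtr_ge0.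
    rewrite -sqrtr_sqr; congr Num.sqrt.
    rewrite !exprMn exprVn c2 lnp sqr_sqrtr// /k1; ring.
  have hs1 : Lam / (sigma * c) <= Num.sqrt s1.
    rewrite -[leLHS]ger0_norm; last by rewrite divr_ge0// mulr_ge0// ltW.
    rewrite -sqrtr_sqr; apply: ler_wsqrtr.
    rewrite exprMn exprVn sqr_sqrtr; last by apply: sumr_ge0 => j _; exact: sqr_ge0.
    rewrite ler_pdivrMr ?exprn_gt0 ?mulr_gt0//.
    apply: le_trans (sum_sqr_slope_weight_le sigma s0 sn) _.
    rewrite exprMn c2 (_ : s1 * _ = sigma ^+ 2 *
      (s%:R * ln (2 * expR 1 * n%:R / s%:R)))// /s1.
    by field; rewrite gt_eqF//; lra.
  have Lam_le : Lam <= Num.sqrt s1 * (sigma * c) by rewrite -ler_pdivrMr ?mulr_gt0.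
  have W : 0 < rho * sigma * c ^+ 2 by rewrite !mulr_gt0 ?exprn_gt0//; lra.
  rewrite -(ler_pM2l W).
  set z := Num.sqrt s1 in Lam_le *; set x := l2 hb in cone *; set y := l2 hm in cone *.
  set r := Num.sqrt k%:R in cone *.
  have z0 : 0 <= z by exact: sqrtr_ge0.
  have -> : rho * sigma * c ^+ 2 * (l1 hb + (Jt + Jr) / (sigma * c)) =
      rho * sigma * c ^+ 2 * l1 hb + c * (rho * (Jt + Jr)) by field; rewrite !gt_eqF.
  have -> : rho * sigma * c ^+ 2 * (5 * (4 * r * q / c * x + z * y)) =
      20 * rho * c * (sigma * q * r * x) + 5 * rho * c * ((z * (sigma * c)) * y).
    by field; rewrite gt_eqF.
  have r1 : rho * sigma * c ^+ 2 * l1 hb <= nu * l1 hb.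
    apply: ler_wpM2r; first by apply: sumr_ge0.
    rewrite nuE c2; have := ler_wpM2l (ltW sigma0) hp; lra.
  have J0 : 0 <= rho * (Jt + Jr).
    rewrite mulr_ge0// addr_ge0//; apply: sumr_ge0 => j _.
    by rewrite mulr_ge0 ?sorted_abs_ge0 ?lam0.
  have r2 : c * (rho * (Jt + Jr)) <= rho * (Jt + Jr) by rewrite ler_piMl.
  have r3 : 16 * (sigma * q * r * x) <= 20 * rho * c * (sigma * q * r * x).
    apply: ler_wpM2r; last by nra.
    by rewrite !mulr_ge0 ?sqrtr_ge0// ltW.
  have r4 : 4 * (rho * (Lam * y)) <= 5 * rho * c * ((z * (sigma * c)) * y).
    apply: (@le_trans _ _ (5 * rho * c * (Lam * y))).
      by rewrite mulrA ler_wpM2r ?mulr_ge0//; nra.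
    by rewrite ler_wpM2l ?ler_wpM2r// !mulr_ge0// ltW.
  have e1 : 4 * (nu * (r * x)) = 16 * (sigma * q * r * x) by rewrite nuE; ring.
  by move: r1 r2 r3 r4 e1 cone; clear; lra.
have [RE1 RE2] := RE hb hm in_cone.
have DE : D = sqnorm (mulXv X hb) + sqnorm hm + 2 * dotp (mulXv X hb) hm.
  rewrite /D /sqnorm /dotp mulr_sumr -!big_split/=.
  by apply: eq_bigr => i _; rewrite /hm; ring.
have K0 : 0 < kappa1 - 2 * kappa2 by lra.
(* As [b1 <= l1 hb], the first term of [D_le] is at most [3/2 * nu * b1], and [3/2 * 4 = 6]. The
   second coefficient is relaxed from 3/2 to 2, which squares to the stated 4. *)
have main : (kappa1 - 2 * kappa2) * (l2 hb ^+ 2 + l2 hm ^+ 2) <=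
    (6 * sigma * q * Num.sqrt k%:R) * l2 hb + (2 * rho * Lam) * l2 hm.
  rewrite !sqr_l2.
  have := ler_norm (- dotp (mulXv X hb) hm); rewrite normrN => hd.
  apply: (@le_trans _ _ D); first by rewrite DE; lra.
  apply: le_trans D_le _; rewrite nuE in nub1 nuble *; lra.
have := quadratic_le K0 main; rewrite !sqr_l2 => /le_trans; apply.
rewrite !exprMn lnp sqr_sqrtr// [Lam ^+ 2]sqr_sqrtr; last first.
  by apply: sumr_ge0 => j _; exact: sqr_ge0.
apply: ler_wpM2r; first by rewrite invr_ge0 sqr_ge0.
lra.
Qed.

End Deterministic.

(** * The good event, its probability, and the two final bounds *)

Unset Implicit Arguments.

Theorem theorem3 (R : realType) (d : measure_display) (T : measurableType d)
  (P : probability T R) (n p k s : nat) (X : 'M[R]_(n, p))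
  (bstar : 'I_p -> R) (mstar : 'I_n -> R) (eps : 'I_n -> T -> R)
  (sigma rho kappa1 kappa2 : R) :
  (0 < k)%N -> (0 < s)%N -> (s <= n)%N ->
  (forall j : 'I_p, \sum_(i < n) X i j ^+ 2 = 1) ->
  (l0 bstar <= k)%N -> (l0 mstar <= s)%N ->
  0 < sigma -> iid_gaussian P eps sigma ->
  let lamf := fun j : nat => sigma * Num.sqrt (ln ((2 * n)%:R / j.+1%:R)) in
  let lam := fun j : 'I_n => lamf (nat_of_ord j) in
  let nu := 4 * sigma * Num.sqrt (ln p%:R) in
  2 * (4 + Num.sqrt 2) <= rho ->
  rho * ln 2 / 4 <= Num.sqrt (ln p%:R) ->
  let k1 := 16 * k%:R * ln p%:R / ln 2 in
  let s1 := s%:R * ln (2 * expR 1 * n%:R / s%:R) / ln 2 in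
  0 < kappa2 -> 2 * kappa2 < kappa1 ->
  (forall (b : 'I_p -> R) (m : 'I_n -> R),
     l1 b + \sum_(j < n) (lam j / lamf n.-1) * sorted_abs m j
       <= 5 * (Num.sqrt k1 * l2 b + Num.sqrt s1 * l2 m) ->
     kappa1 * (sqnorm b + sqnorm m) <= sqnorm (mulXv X b) + sqnorm m /\
     `|dotp (mulXv X b) m| <= kappa2 * (sqnorm b + sqnorm m)) ->
  let kappa := Num.sqrt (kappa1 - 2 * kappa2) in
  let y := fun (w : T) (i : 'I_n) => mulXv X bstar i + mstar i + eps i w in
  let obj := fun (w : T) (b : 'I_p -> R) (m : 'I_n -> R) =>
    sqnorm (fun i => y w i - mulXv X b i - m i) + 2 * nu * l1 b
    + 2 * rho * Jsort lam m in
  exists A : set T, measurable A /\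
    ((1 - 2^-1 * (s%:R / (2 * n)%:R) ^+ s - p%:R^-1)%:E <= P A)%E /\
    forall w, A w ->
    forall (bh : 'I_p -> R) (mh : 'I_n -> R),
      (forall b m, obj w bh mh <= obj w b m) ->
      sqnorm (fun j => bh j - bstar j) + sqnorm (fun i => mh i - mstar i)
        <= 36 / kappa ^+ 4 * sigma ^+ 2 * k%:R * ln p%:R
           + 4 * rho ^+ 2 / kappa ^+ 4 * \sum_(j < s) lamf j ^+ 2 /\
      36 / kappa ^+ 4 * sigma ^+ 2 * k%:R * ln p%:R
           + 4 * rho ^+ 2 / kappa ^+ 4 * \sum_(j < s) lamf j ^+ 2
        <= 4 * sigma ^+ 2 / kappa ^+ 4 *
           (9 * k%:R * ln p%:R + rho ^+ 2 * s%:R * ln (2 * expR 1 * n%:R / s%:R)).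
Proof.
move=> k0 s0 sn X1 bk msup sigma0 iid lamf lam nu hrho hp k1 s1 kap20 hkap RE kappa y obj.
have n0 : (0 < n)%N by exact: leq_trans sn.
have ln2 := @ln2_ge R.
have q0 : 0 < Num.sqrt (ln p%:R) :> R.
  apply: lt_le_trans hp; rewrite divr_gt0// mulr_gt0//; last by lra.
  by apply: lt_le_trans hrho; rewrite mulr_gt0// ltr_wpDr ?sqrtr_ge0.
have lnp0 : 0 < ln p%:R :> R by move: q0; rewrite sqrtr_gt0.
(* [p = 0] is excluded by the convention that [ln] takes the value 0 at 0. *)
have p0 : 0 < p%:R :> R.
  rewrite ltr0n lt0n; apply/eqP => p0; move: lnp0.
  by rewrite p0 ln0 ?ltxx.
have K0 : 0 < kappa1 - 2 * kappa2 by lra.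
have kappa4 : kappa ^+ 4 = (kappa1 - 2 * kappa2) ^+ 2.
  by rewrite (_ : 4 = 2 * 2)%N// exprM sqr_sqrtr// ltW.
pose B1 (j : 'I_p) :=
  [set w | 2 * Num.sqrt (ln p%:R) * sigma < `|\sum_i X i j * eps i w|].
pose B2 (I : {set 'I_n}) :=
  [set w | 80 / 3 * slope_entropy n #|I| < \sum_(i in I) (eps i w / sigma) ^+ 2].
have mB1 j : measurable (B1 j).
  have mS := measurable_lincomb iid (X^~ j).
  have mN : measurable_fun setT (fun w => `|\sum_i X i j * eps i w|).
    by apply: measurableT_comp.
  have := mN measurableT _ (measurable_itv `]2 * Num.sqrt (ln p%:R) * sigma, +oo[).
  rewrite setTI (_ : _ @^-1` _ = B1 j)//.
  by apply/seteqP; split => z /=; rewrite in_itv/= andbT.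
have mB2 I : measurable (B2 I) by exact: (measurable_chi_square_gt iid).
pose U1 := \big[setU/set0]_(j < p) B1 j.
pose U2 := \big[setU/set0]_(I : {set 'I_n} | (s <= #|I|)%N) B2 I.
have mU1 : measurable U1 by exact: bigsetU_measurable.
have mU2 : measurable U2 by exact: bigsetU_measurable.
have PU1 : (P U1 <= (p%:R^-1)%:E)%E.
  (* At [t = 2 * sqrt (ln p)] the Gaussian tail is [p ^ -2], and there are [p] columns. *)
  have -> : p%:R^-1 = \sum_(j < p) expR (- (2 * Num.sqrt (ln p%:R)) ^+ 2 / 2) :> R.
    rewrite sumr_const card_ord -[RHS]mulr_natl exprMn sqr_sqrtr ?(ltW lnp0)//.
    have -> : - (2 ^+ 2 * ln p%:R) / 2 = - (2%:R * ln p%:R) :> R by lra.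
    rewrite expRN expRM_natl lnK ?posrE//.
    by field; rewrite gt_eqF.
  apply: probability_bigsetU_le => // j _.
  by apply: gaussian_tail => //; rewrite mulr_ge0// ltW.
have PU2 : (P U2 <= (2^-1 * (s%:R / (2 * n)%:R) ^+ s)%:E)%E.
  apply: (@le_trans _ _ (\sum_(I : {set 'I_n} | (s <= #|I|)%N)
      2 ^+ #|I| * expR (- 10 * slope_entropy n #|I|))%:E).
    apply: probability_bigsetU_le => // I _.
    apply: le_trans (chi_square_tail iid sigma0 I _) _.
    (* The Chernoff exponent times the threshold is 3/8 * 80/3 = 10. *)
    rewrite lee_fin ler_wpM2l ?exprn_ge0// ler_expR; lra.
  by rewrite lee_fin sum_subsets_tail_le.
(* The event depends on the noise alone, so the bound holds for all minimisers at once and no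
   measurable selection enters. *)
exists (~` (U1 `|` U2)); split; first by apply: measurableC; exact: measurableU.
split.
  rewrite probability_setC; last exact: measurableU.
  have fU : P (U1 `|` U2) \is a fin_num by apply: fin_num_measure; exact: measurableU.
  have : fine (P (U1 `|` U2)) <= p%:R^-1 + 2^-1 * (s%:R / (2 * n)%:R) ^+ s.
    rewrite -lee_fin fineK// EFinD.
    exact: le_trans (measureU2 P mU1 mU2) (leeD PU1 PU2).
  by rewrite -(fineK fU) -EFinB lee_fin; lra.
move=> w /not_orP[w1 w2] bh mh hopt; split.
  have := @slope_rate R n p k s X bstar mstar (eps^~ w) sigma rho kappa1 kappa2 bh mh
    s0 sn bk msup sigma0 hrho hp hkap RE.
  rewrite /= big_mkord => /(_ _ _ hopt) h.
  rewrite kappa4; apply: le_trans (h _ _) _.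
  - move=> j; rewrite leNgt; apply/negP => hj; apply: w1.
    by rewrite /U1 (bigD1 j)//=; left.
  - move=> I sI; rewrite leNgt; apply/negP => hj; apply: w2.
    by rewrite /U2 (bigD1 I)//=; left.
  by rewrite le_eqVlt; apply/orP; left; apply/eqP; field; rewrite gt_eqF.
have := sum_sqr_slope_weight_le sigma s0 sn; rewrite big_mkord => h.
rewrite kappa4.
have r0 : 0 <= 4 * rho ^+ 2 / (kappa1 - 2 * kappa2) ^+ 2.
  by rewrite divr_ge0 ?sqr_ge0// mulr_ge0 ?sqr_ge0.
apply: le_trans (lerD (lexx _) (ler_wpM2l r0 h)) _.
by rewrite le_eqVlt; apply/orP; left; apply/eqP; field; rewrite gt_eqF.
Qed.
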